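(* Let $x\in(0,\infty)$ and assume that $f(x)\neq0$ and $f'(x)\neq 0$. Then the asymptotically optimal choice of $m$ for estimating $F(x)$ with respect to MSE is $$m_{opt}=n^{2/3}\left[\frac{4(b^S(x))^2}{V^S(x)}\right]^{2/3},$$ and the associated MSE can be written, as $n\to\infty$, as $$\operatorname{MSE}\left[\hat F^S_{m_{opt},n}(x)\right]=n^{-1}\sigma^2(x)-\frac34 n^{-4/3}\left[\frac{(V^S(x))^4}{4(b^S(x))^2}\right]^{1/3}+o_x(n^{-4/3}),$$ where $\sigma^2(x)=F(x)(1-F(x))$, $V^S(x)=f(x)\left[\frac{x}{\pi}\right]^{1/2}$ and $b^S(x)=\frac{xf'(x)}{2}$.
   Context: Let $X_1,X_2,\dots$ be i.i.d. random variables with values in $[0,\infty)$, with distribution function $F$ ($F(0)=0$) and density $f$. Standing assumption: $F$ is continuous, and the first and second derivatives $f=F'$ and $f'=F''$ of $F$ exist and are continuous and bounded on $[0,\infty)$. The empirical distribution function is $F_n(x)=\frac1n\sum_{i=1}^n \mathbb{I}(X_i\le x)$. For $m>0$, $k\in\{0,1,2,\dots\}$ and $x\ge 0$ let $V_{k,m}(x)=e^{-mx}\frac{(mx)^k}{k!}$ (with $0^0=1$). The Szasz estimator is $\hat F^S_{m,n}(x)=\sum_{k=0}^\infty F_n\left(\frac km\right)V_{k,m}(x)$ and $\operatorname{MSE}[\hat F^S_{m,n}(x)]=\mathbb{E}\left[\left(\hat F^S_{m,n}(x)-F(x)\right)^2\right]$. ''Asymptotically optimal with respect to MSE'' means: minimizing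 over $m>0$ the leading part $n^{-1}\sigma^2(x)-m^{-1/2}n^{-1}V^S(x)+m^{-2}(b^S(x))^2$ of the asymptotic expansion $\operatorname{MSE}[\hat F^S_{m,n}(x)]=n^{-1}\sigma^2(x)-m^{-1/2}n^{-1}V^S(x)+m^{-2}(b^S(x))^2+o_x(m^{-2})+o_x(m^{-1/2}n^{-1})$ as $m,n\to\infty$. Since $m_{opt}$ need not be an integer, the formula defining the estimator is used with a real parameter $m>0$. The notation $u=o_x(v)$ means $\lim|u/v|=0$, where the rate of convergence may depend on $x$. *)

(* Defs.v *)
From HB Require Import structures.
From mathcomp Require Export all_boot all_order all_algebra finmap.
From mathcomp Require Export all_classical all_reals all_analysis.
Export Order.TTheory GRing.Theory Num.Theory numFieldNormedType.Exports.

Set Implicit Arguments.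
Unset Strict Implicit.
Unset Printing Implicit Defensive.

Local Open Scope classical_set_scope.
Local Open Scope ring_scope.

Definition mutually_independent d (T : measurableType d) (R : realType)
    (P : probability T R) (X : nat -> {RV P >-> R}) : Prop :=
  forall (J : {fset nat}) (A : nat -> set R), (forall i, measurable (A i)) ->
    P (\bigcap_(i in [set` J]) X i @^-1` A i) =
    (\prod_(i <- J) P (X i @^-1` A i))%E.

(* [g'] is the derivative of [g] on [0, +oo[; the derivative at the endpoint 0
   is the right derivative. *)
Definition derivative_on_nneg (R : realType) (g g' : R -> R) : Prop :=
  (forall y : R, 0 < y -> is_derive y 1 g (g' y)) /\
  h^-1 * (g h - g 0) @[h --> (0 : R)^'+] --> g' 0.

Section szasz_estimator.
Context d (T : measurableType d) (R : realType) (P : probability T R).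
Variable X : nat -> {RV P >-> R}.

(* The sample of size n is X 0, ..., X n.-1. *)
Definition empirical_df (n : nat) (y : R) (w : T) : R :=
  n%:R^-1 * \sum_(i < n) (X i w <= y)%R%:R.

Definition szasz_weight (k : nat) (m x : R) : R :=
  expR (- (m * x)) * ((m * x) ^+ k / k`!%:R).

Definition szasz_estimator (m : R) (n : nat) (x : R) (w : T) : R :=
  limn (series (fun k => empirical_df n (k%:R / m) w * szasz_weight k m x)).

(* The integrand takes values in [0, 1], so [fine] loses no information. *)
Definition szasz_mse (F : R -> R) (m : R) (n : nat) (x : R) : R :=
  fine 'E_P[fun w => (szasz_estimator m n x w - F x) ^+ 2].

End szasz_estimator.

Section constants.
Context (R : realType).
Variables (F f f' : R -> R).

Definition sigma2 (x : R) : R := F x * (1 - F x).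
Definition VS (x : R) : R := f x * (x / pi) `^ (1 / 2).
Definition bS (x : R) : R := x * f' x / 2.

Definition mse_leading_part (x m : R) (n : nat) : R :=
  n%:R^-1 * sigma2 x - m `^ (- (1 / 2)) * n%:R^-1 * VS x
  + m `^ (- 2) * bS x ^+ 2.

Definition m_opt (x : R) (n : nat) : R :=
  n%:R `^ (2 / 3) * (4 * bS x ^+ 2 / VS x) `^ (2 / 3).

End constants.

(* Only used with [v] nonzero along [G], so that [u / v] is a genuine quotient. *)
Definition little_o (R : realType) (I : Type) (G : set_system I)
    (u v : I -> R) : Prop :=
  `|u i / v i| @[i --> G] --> (0 : R).

(* [L] is the leading part of the expansion of [E] as m, n --> +oo (jointly,
   with no relation between m and n), up to o(m^-2) + o(m^(-1/2) n^-1). *)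
Definition has_leading_part (R : realType) (E L : R -> nat -> R) : Prop :=
  exists r1 r2 : R * nat -> R,
    [/\ little_o (filter_prod (pinfty_nbhs R) \oo) r1 (fun p => p.1 `^ (- 2)),
        little_o (filter_prod (pinfty_nbhs R) \oo) r2
          (fun p => p.1 `^ (- (1 / 2)) * p.2%:R^-1) &
        forall m n, 0 < m -> (0 < n)%N -> E m n = L m n + r1 (m, n) + r2 (m, n)].

Definition minimizes_on_pos (R : realType) (g : R -> R) (m : R) : Prop :=
  0 < m /\ forall m', 0 < m' -> g m <= g m'.

Definition asymptotically_optimal (R : realType) (E L : R -> nat -> R)
    (mo : nat -> R) : Prop :=
  has_leading_part E L /\
  forall n, (0 < n)%N -> minimizes_on_pos (L^~ n) (mo n).

(* Main.v *)
Require Import Defs.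
From mathcomp Require Import ring lra measurable_realfun.

(* Let N and N' be independent Poisson variables of mean m x. The estimator is
   the mean of n i.i.d. terms Y_i = P(N >= m X_i), so that its MSE is
   (E Y^2 - (E Y)^2) / n + (E Y - F x)^2 with E Y = E F(N / m) and
   E Y^2 = E F(min(N, N') / m). A second-order Taylor expansion of F at x and
   the moments of N of order at most 4 give E Y = F x + x f'(x) / (2 m) + o(1/m)
   and E Y^2 = F x + f(x) (E min(N, N') / m - x) + O(1/m).
   Stein's identity E[N g(N)] = m x E[g(N + 1)] turns m x - E min(N, N') into
   m x (P(N = N') + P(N = N' + 1)), and, as N + N' is Poisson of mean 2 m x,
   into E b(N + N') with b(s) = (s / 2) C(2j, j) / 4^j, j = floor(s / 2).
   Wallis' inequalities bound b(s)^2 - s / (2 pi), whence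
   m x - E min(N, N') = sqrt(m x / pi) + O(1).
   Finally, in the variable t = m^(-1/2), the leading part differs from its
   minimum by b (t - t0)^2 (t^2 + 2 t t0 + 3 t0^2), where b = (b^S(x))^2 and
   t0 is the value of t at m = m_opt. *)

Local Open Scope classical_set_scope.
Local Open Scope ring_scope.

Local Open Scope classical_set_scope.
Local Open Scope ring_scope.

(** * Sums of real series, by a relation that carries convergence and value at once *)

Definition has_sum {R : realType} (a : nat -> R) (l : R) : Prop :=
  series a @ \oo --> l.

Section has_sum.
Context {R : realType}.
Implicit Types (a b : nat -> R) (l k : R).

Lemma has_sum_lim {a l} : has_sum a l -> limn (series a) = l.
Proof. by move=> al; apply/cvg_lim. Qed.

Lemma has_sum_unique {a k l} : has_sum a k -> has_sum a l -> k = l.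
Proof. by move=> /has_sum_lim <- /has_sum_lim <-. Qed.

Lemma eq_has_sum {a b l} : a =1 b -> has_sum a l -> has_sum b l.
Proof. by move=> /funext ->. Qed.

Lemma has_sumD {a b k l} :
  has_sum a k -> has_sum b l -> has_sum (fun i => a i + b i) (k + l).
Proof.
move=> ak bl; rewrite /has_sum (_ : (fun i => _) = a + b)// seriesD.
exact: cvgD.
Qed.

Lemma has_sumZ {a} c {l} : has_sum a l -> has_sum (fun i => c * a i) (c * l).
Proof.
move=> al; rewrite /has_sum (_ : (fun i => _) = c *: a)// seriesZ.
exact: cvgZl_tmp.
Qed.

Lemma has_sumB {a b k l} :
  has_sum a k -> has_sum b l -> has_sum (fun i => a i - b i) (k - l).
Proof.
move=> ak bl; rewrite /has_sum (_ : (fun i => _) = a - b)// seriesD seriesN.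
exact: cvgB.
Qed.

Lemma has_sum0 : has_sum (fun=> 0 : R) 0.
Proof.
rewrite /has_sum (_ : series _ = cst 0); first exact: cvg_cst.
by apply/funext => n; rewrite /series /= big1.
Qed.

Lemma has_sum_big {I : Type} (r : seq I) {a : I -> nat -> R} {l : I -> R} :
  (forall i, has_sum (a i) (l i)) ->
  has_sum (fun n => \sum_(i <- r) a i n) (\sum_(i <- r) l i).
Proof.
move=> al; elim: r => [|i r IHr].
  by rewrite big_nil; apply: (eq_has_sum _ has_sum0) => n; rewrite big_nil.
rewrite big_cons; apply: (eq_has_sum _ (has_sumD (al i) IHr)) => n.
by rewrite big_cons.
Qed.

Lemma has_sum_partial_le {a l} n :
  (forall i, 0 <= a i) -> has_sum a l -> \sum_(i < n) a i <= l.
Proof.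
move=> a0 al; rewrite -(has_sum_lim al) -(big_mkord xpredT a).
apply: (nondecreasing_cvgn_le (u_ := series a)); last by apply/cvg_ex; exists l.
by apply: nondecreasing_series => i _ _; exact: a0.
Qed.

(** Comparison test through absolute convergence; the existential form serves for sums without a
    closed form. *)
Lemma has_sum_dominated {a b l} : (forall i, `|a i| <= b i) -> has_sum b l ->
  exists2 k, has_sum a k & `|k| <= l.
Proof.
move=> ab bl.
have cn : cvgn [normed series a].
  apply: (series_le_cvg (v_ := b)) => // [n|n|]; last by apply/cvg_ex; exists l.
  - exact: normr_ge0.
  - exact: le_trans (ab n).
exists (limn (series a)); first exact: (normed_cvg cn).
apply: le_trans (lim_series_norm cn) _; rewrite -(has_sum_lim bl).
by apply: lim_series_le => //; apply/cvg_ex; exists l.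
Qed.

Lemma has_sum_norm_le {a b k l} :
  (forall i, `|a i| <= b i) -> has_sum a k -> has_sum b l -> `|k| <= l.
Proof.
move=> ab ak bl; have [k' ak' k'l] := has_sum_dominated ab bl.
by rewrite (has_sum_unique ak ak').
Qed.

Lemma has_sum_shift {a l} :
  has_sum (fun i => a i.+1) l -> has_sum a (a 0%N + l).
Proof.
move=> al; rewrite /has_sum -cvg_shiftS /=.
have -> : (fun n => series a n.+1) = cst (a 0%N) + series (fun i => a i.+1).
  by apply/funext => n; rewrite /series /= big_nat_recl.
by apply: cvgD => //; exact: cvg_cst.
Qed.

Lemma has_sum_telescope {a l} :
  a @ \oo --> l -> has_sum (fun i => a i - a i.+1) (a 0%N - l).
Proof.
move=> al; rewrite /has_sum (_ : series _ = cst (a 0%N) - a).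
  by apply: cvgB => //; exact: cvg_cst.
apply/funext => n; rewrite /series /= -[RHS]opprB -(telescope_sumr a (leq0n n)).
by rewrite -sumrN; apply: eq_bigr => i _; rewrite opprB.
Qed.

(** The new partial sums are those of [a] at even ranks, a subsequence of a convergent sequence. *)
Lemma has_sum_pair {a l} :
  has_sum a l -> has_sum (fun i => a i.*2 + a i.*2.+1) l.
Proof.
move=> al; rewrite /has_sum (_ : series _ = series a \o double).
  apply: (cvg_comp _ _ _ al) => A [N _ NA]; exists N => // n /= Nn.
  by apply: NA => /=; rewrite (leq_trans Nn)// -addnn leq_addr.
apply/funext; elim=> [|n IH]; first by rewrite /series /= !big_geq.
by rewrite seriesSr IH /= doubleS !seriesSr addrA.
Qed.

End has_sum.

(** * Poisson weights: moments, tails, and the minimum of two independent copies *)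

Section poisson.
Context {R : realType}.
Implicit Types lam : R.

Definition poisson_weight lam (k : nat) : R :=
  expR (- lam) * (lam ^+ k / k`!%:R).

(** The probability of being at least [k]; subtracting a finite sum from 1 makes the recurrence in
    [k] immediate. *)
Definition poisson_tail lam (k : nat) : R :=
  1 - \sum_(j < k) poisson_weight lam j.

(* The probability that the minimum of two independent Poisson variables of
   mean [lam] equals [k]. *)
Definition poisson_min_weight lam (k : nat) : R :=
  poisson_weight lam k * (poisson_tail lam k + poisson_tail lam k.+1).

Lemma poisson_weight_ge0 lam k : 0 <= lam -> 0 <= poisson_weight lam k.
Proof. by move=> lam0; rewrite mulr_ge0 ?expR_ge0// divr_ge0// exprn_ge0. Qed.

Lemma poisson_weightS lam k :
  k.+1%:R * poisson_weight lam k.+1 = lam * poisson_weight lam k.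
Proof.
rewrite /poisson_weight exprS factS natrM; field.
by rewrite nat1r !pnatr_eq0 -lt0n fact_gt0.
Qed.

Lemma has_sum_poisson_weight lam : has_sum (poisson_weight lam) 1.
Proof.
rewrite -(expRxMexpNx_1 (- lam)) opprK; apply: has_sumZ.
exact: is_cvg_series_exp_coeff.
Qed.

(** By [poisson_weightS], the terms shift by one rank; the term [k = 0] vanishes. *)
Lemma poisson_stein lam {g : nat -> R} {l} :
  has_sum (fun k => g k.+1 * poisson_weight lam k) l ->
  has_sum (fun k => k%:R * g k * poisson_weight lam k) (lam * l).
Proof.
move=> gl; have := has_sum_shift (a := fun k => k%:R * g k * poisson_weight lam k).
rewrite !mul0r => /(_ (lam * l)); rewrite add0r; apply.
apply: (eq_has_sum _ (has_sumZ lam gl)) => k.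
by rewrite mulrCA -poisson_weightS; ring.
Qed.

Lemma poisson_moment1 lam :
  has_sum (fun k => k%:R * poisson_weight lam k) lam.
Proof.
rewrite -[X in has_sum _ X]mulr1.
have := poisson_stein lam (g := fun=> 1) (l := 1).
under eq_fun do rewrite mul1r; move=> /(_ (has_sum_poisson_weight lam)).
by apply: (eq_has_sum _) => k; rewrite mulr1.
Qed.

(** Stein's identity with [g k = k] reduces this moment to lower ones, once [k + 1] is expanded. The
    next two moments follow in the same way from higher powers. *)
Lemma poisson_moment2 lam :
  has_sum (fun k => k%:R ^+ 2 * poisson_weight lam k) (lam * (lam + 1)).
Proof.
have := has_sumD (poisson_moment1 lam) (has_sum_poisson_weight lam).
move=> /(eq_has_sum (b := fun k => k.+1%:R * poisson_weight lam k)).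
have h k : k%:R * poisson_weight lam k + poisson_weight lam k =
  k.+1%:R * poisson_weight lam k by rewrite -natr1; ring.
move=> /(_ h) /(poisson_stein lam (g := fun k => k%:R)).
by apply: (eq_has_sum _) => k; rewrite expr2.
Qed.

Lemma poisson_moment3 lam :
  has_sum (fun k => k%:R ^+ 3 * poisson_weight lam k)
    (lam * (lam * (lam + 1) + 2 * lam + 1)).
Proof.
have := has_sumD (has_sumD (poisson_moment2 lam) (has_sumZ 2 (poisson_moment1 lam)))
  (has_sum_poisson_weight lam).
move=> /(eq_has_sum (b := fun k => k.+1%:R ^+ 2 * poisson_weight lam k)).
have h k : k%:R ^+ 2 * poisson_weight lam k + 2 * (k%:R * poisson_weight lam k) +
  poisson_weight lam k = k.+1%:R ^+ 2 * poisson_weight lam k.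
  by rewrite -natr1; ring.
move=> /(_ h) /(poisson_stein lam (g := fun k => k%:R ^+ 2)).
by apply: (eq_has_sum _) => k; rewrite (exprS _ 2).
Qed.

Lemma poisson_moment4 lam :
  has_sum (fun k => k%:R ^+ 4 * poisson_weight lam k)
    (lam * (lam * (lam * (lam + 1) + 2 * lam + 1) + 3 * (lam * (lam + 1))
      + 3 * lam + 1)).
Proof.
have := has_sumD (has_sumD (has_sumD (poisson_moment3 lam)
  (has_sumZ 3 (poisson_moment2 lam))) (has_sumZ 3 (poisson_moment1 lam)))
  (has_sum_poisson_weight lam).
move=> /(eq_has_sum (b := fun k => k.+1%:R ^+ 3 * poisson_weight lam k)).
have h k : k%:R ^+ 3 * poisson_weight lam k +
  3 * (k%:R ^+ 2 * poisson_weight lam k) + 3 * (k%:R * poisson_weight lam k) +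
  poisson_weight lam k = k.+1%:R ^+ 3 * poisson_weight lam k.
  by rewrite -natr1; ring.
move=> /(_ h) /(poisson_stein lam (g := fun k => k%:R ^+ 3)).
by apply: (eq_has_sum _) => k; rewrite (exprS _ 3).
Qed.

Lemma poisson_variance lam :
  has_sum (fun k => (k%:R - lam) ^+ 2 * poisson_weight lam k) lam.
Proof.
have := has_sumD (has_sumD (poisson_moment2 lam)
  (has_sumZ (- (2 * lam)) (poisson_moment1 lam)))
  (has_sumZ (lam ^+ 2) (has_sum_poisson_weight lam)).
rewrite [X in has_sum _ X](_ : _ = lam); last by ring.
by apply: (eq_has_sum _) => k; ring.
Qed.

Lemma poisson_central_moment4 lam :
  has_sum (fun k => (k%:R - lam) ^+ 4 * poisson_weight lam k)
    (3 * lam ^+ 2 + lam).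
Proof.
have := has_sumD (has_sumD (has_sumD (has_sumD (poisson_moment4 lam)
  (has_sumZ (- (4 * lam)) (poisson_moment3 lam)))
  (has_sumZ (6 * lam ^+ 2) (poisson_moment2 lam)))
  (has_sumZ (- (4 * lam ^+ 3)) (poisson_moment1 lam)))
  (has_sumZ (lam ^+ 4) (has_sum_poisson_weight lam)).
rewrite [X in has_sum _ X](_ : _ = 3 * lam ^+ 2 + lam); last by ring.
by apply: (eq_has_sum _) => k; ring.
Qed.

Lemma poisson_tail0 lam : poisson_tail lam 0 = 1.
Proof. by rewrite /poisson_tail big_ord0 subr0. Qed.

Lemma poisson_tailS lam k :
  poisson_tail lam k.+1 = poisson_tail lam k - poisson_weight lam k.
Proof. by rewrite /poisson_tail big_ord_recr /=; ring. Qed.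

Lemma poisson_tail_ge0 lam k : 0 <= lam -> 0 <= poisson_tail lam k.
Proof.
move=> lam0; rewrite subr_ge0 (has_sum_partial_le (a := poisson_weight lam))//.
  by move=> i; exact: poisson_weight_ge0.
exact: has_sum_poisson_weight.
Qed.

Lemma poisson_tail_le1 lam k : 0 <= lam -> poisson_tail lam k <= 1.
Proof.
by move=> lam0; rewrite gerBl sumr_ge0// => i _; exact: poisson_weight_ge0.
Qed.

Lemma poisson_tail_cvg0 lam : poisson_tail lam @ \oo --> 0.
Proof.
rewrite (_ : poisson_tail lam = cst 1 - series (poisson_weight lam)).
  rewrite -(subrr 1); apply: (cvgB _ (has_sum_poisson_weight lam)).
  exact: cvg_cst.
by apply/funext => k; rewrite /poisson_tail -(big_mkord xpredT).
Qed.

Lemma poisson_tail_sqr_cvg0 lam : (fun k => poisson_tail lam k ^+ 2) @ \oo --> 0.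
Proof.
rewrite -(mulr0 0) (_ : (fun k => _) = poisson_tail lam * poisson_tail lam).
  exact: cvgM (poisson_tail_cvg0 lam) (poisson_tail_cvg0 lam).
by apply/funext => k; rewrite expr2.
Qed.

(** The squared tail is the probability that both variables are at least [k], so the law of the
    minimum telescopes. *)
Lemma poisson_min_weightE lam k : poisson_min_weight lam k =
  poisson_tail lam k ^+ 2 - poisson_tail lam k.+1 ^+ 2.
Proof. by rewrite /poisson_min_weight poisson_tailS; ring. Qed.

Lemma poisson_min_weight_ge0 lam k :
  0 <= lam -> 0 <= poisson_min_weight lam k.
Proof.
by move=> ?; rewrite mulr_ge0 ?poisson_weight_ge0// addr_ge0 ?poisson_tail_ge0.
Qed.

(** The minimum is [k] only if one of the two variables is [k]; this controls moments of the minimum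
    by Poisson moments. *)
Lemma poisson_min_weight_le lam k :
  0 <= lam -> poisson_min_weight lam k <= 2 * poisson_weight lam k.
Proof.
move=> lam0; rewrite /poisson_min_weight mulrC ler_wpM2r ?poisson_weight_ge0//.
by rewrite (_ : 2 = 1 + 1)// lerD// poisson_tail_le1.
Qed.

Lemma has_sum_poisson_min_weight lam : has_sum (poisson_min_weight lam) 1.
Proof.
have := has_sum_telescope (poisson_tail_sqr_cvg0 lam).
rewrite poisson_tail0 subr0 expr1n; apply: (eq_has_sum _) => k.
by rewrite poisson_min_weightE.
Qed.

(** Stein's identity for [g k = T_k + T_(k+1)], with [T] the tail and [v] the weight:
    [g (k + 1) = g k - v_k - v_(k+1)], which averages to [1 - l]. *)
Lemma poisson_min_moment1 {lam l} :
  has_sum (fun k => poisson_weight lam k *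
    (poisson_weight lam k + poisson_weight lam k.+1)) l ->
  has_sum (fun k => k%:R * poisson_min_weight lam k) (lam * (1 - l)).
Proof.
move=> hl; have := poisson_stein lam
  (g := fun k => poisson_tail lam k + poisson_tail lam k.+1) (l := 1 - l).
move=> h; apply: (eq_has_sum _ (h _)) => [k|].
  by rewrite /poisson_min_weight; ring.
apply: (eq_has_sum _ (has_sumB (has_sum_poisson_min_weight lam) hl)) => k.
by rewrite /poisson_min_weight !poisson_tailS; ring.
Qed.

End poisson.

(** * Wallis integrals and central binomial coefficients *)

Section wallis.
Context {R : realType}.

(** The reduction formula for powers of the sine, taken as a definition: explicit primitives replace
    integration. *)
Fixpoint sin_pow_primitive (n : nat) : R -> R :=
  match n with
  | 0 => id
  | 1 => - cos
  | k.+2 => k.+2%:R^-1 *: (k.+1%:R *: sin_pow_primitive k - cos * sin ^+ k.+1)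
  end.

Lemma is_derive_sin_pow_primitive n (t : R) :
  is_derive t 1 (sin_pow_primitive n) (sin t ^+ n).
Proof.
elim/ltn_ind: n => -[|[|n]] IH.
- by rewrite expr0; exact: is_derive_id.
- by rewrite expr1 -[sin t]opprK; apply: is_deriveN.
- have IHn := IH n (leqW (leqnn _)).
  apply: is_derive_eq; rewrite !fctE /GRing.scale /=.
  apply: (mulfI (x := n.+2%:R)); first by rewrite pnatr_eq0.
  rewrite mulVKf ?pnatr_eq0//.
  have c2 : cos t * cos t = 1 - sin t * sin t.
    by rewrite -(cos2Dsin2 t) !expr2 addrK.
  rewrite [cos t * _](_ : _ = n.+1%:R * sin t ^+ n * (cos t * cos t)); last by ring.
  by rewrite c2 !exprS -!natr1; ring.
Qed.

(* The integral of [sin ^+ n] over [0, pi / 2]. *)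
Definition wallis n : R := sin_pow_primitive n (pi / 2) - sin_pow_primitive n 0.

Lemma wallis0 : wallis 0 = pi / 2.
Proof. by rewrite /wallis /= subr0. Qed.

Lemma wallis1 : wallis 1 = 1.
Proof. by rewrite /wallis /= !fctE cos_pihalf cos0 opprK oppr0 add0r. Qed.

Lemma wallisSS n : wallis n.+2 = n.+1%:R / n.+2%:R * wallis n.
Proof.
rewrite /wallis /= !fctE /= cos_pihalf sin0 !exprS !mul0r /GRing.scale /=.
by ring.
Qed.

(** Mean value theorem for the difference of the two primitives, whose derivative
    [sin ^+ n * (1 - sin)] is nonnegative on [[0, pi / 2]]. *)
Lemma wallis_noninc n : wallis n.+1 <= wallis n.
Proof.
have dn := is_derive_sin_pow_primitive n.
have dn1 := is_derive_sin_pow_primitive n.+1.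
rewrite -subr_ge0 /wallis; move: (sin_pow_primitive n) (sin_pow_primitive n.+1) dn dn1.
move=> g h dg dh.
have pi2 : 0 < pi / 2 :> R by rewrite divr_gt0// pi_gt0.
have dgh (t : R) : is_derive t 1 (g - h) (sin t ^+ n - sin t ^+ n.+1).
  exact: is_deriveB.
have [|c] := MVT pi2 (fun t _ => dgh t).
  by apply: derivable_within_continuous => t _; have [] := dgh t.
rewrite in_itv /= => /andP[c0 c2] e.
rewrite (_ : _ - _ = (g - h) (pi / 2) - (g - h) 0); last by rewrite !fctE; ring.
rewrite e subr0 mulr_ge0 ?(ltW pi2)// subr_ge0 exprS.
have s0 : 0 <= sin c by rewrite ltW// sin_gt0_pihalf// c0.
by rewrite ler_piMl ?exprn_ge0// sin_le1.
Qed.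

(** This is ['C(2j, j) / 4 ^ j], the probability that [2j] fair coin tosses give [j] heads. *)
Definition central_binom (j : nat) : R :=
  (j.*2)`!%:R / (j`!%:R ^+ 2 * 4 ^+ j).

Lemma fact_neq0 j : j`!%:R != 0 :> R.
Proof. by rewrite pnatr_eq0 -lt0n fact_gt0. Qed.

Lemma central_binom0 : central_binom 0 = 1.
Proof. by rewrite /central_binom double0 fact0 expr1n expr0 mulr1 divr1. Qed.

Lemma central_binomS j :
  central_binom j.+1 = central_binom j * (j.*2.+1%:R / j.*2.+2%:R).
Proof.
rewrite /central_binom doubleS !factS !natrM [4 ^+ _]exprS -[j.*2.+2%:R]natr1.
rewrite -[j.*2.+1%:R]natr1 -[j.+1%:R]natr1 -!muln2 !natrM.
by field; rewrite fact_neq0 /= expf_neq0//= !natr1 -!natrM !natr1 !pnatr_eq0.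
Qed.

Lemma central_binom_gt0 j : 0 < central_binom j.
Proof.
by rewrite divr_gt0 ?mulr_gt0 ?exprn_gt0 ?ltr0n ?fact_gt0.
Qed.

Lemma central_binom_le1 j : central_binom j <= 1.
Proof.
elim: j => [|j IH]; first by rewrite central_binom0.
rewrite central_binomS mulr_ile1//; first by rewrite ltW ?central_binom_gt0.
by rewrite ler_pdivrMr ?ltr0n// mul1r ler_nat.
Qed.

Lemma wallis_double j : wallis j.*2 = pi / 2 * central_binom j.
Proof.
elim: j => [|j IH]; first by rewrite wallis0 central_binom0 mulr1.
by rewrite doubleS wallisSS IH central_binomS; ring.
Qed.

Lemma wallis_doubleS j :
  wallis j.*2.+1 = (j.*2.+1%:R * central_binom j)^-1.
Proof.
elim: j => [|j IH]; first by rewrite wallis1 central_binom0 mulr1 invr1.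
rewrite doubleS wallisSS IH central_binomS.
have := central_binom_gt0 j => /gt_eqF h.
by field; rewrite h nat1r -!natrD !pnatr_eq0.
Qed.

(** Comparing the Wallis integrals of ranks [2j + 1] and [2j] gives [1 / ((2j + 1) r) <= pi * r / 2]
    with [r = central_binom j]. *)
Lemma central_binom_ge j : 2 <= pi * (j.*2.+1%:R * central_binom j ^+ 2).
Proof.
have := wallis_noninc j.*2.
rewrite wallis_double wallis_doubleS => h.
have c0 := central_binom_gt0 j.
have d0 : 0 < j.*2.+1%:R * central_binom j by rewrite mulr_gt0// ltr0n.
move: h; rewrite -(ler_pM2r d0) mulVf ?gt_eqF// => h.
by rewrite expr2; lra.
Qed.

(** For positive [j], the Wallis integrals of ranks [2j] and [2j - 1] are compared. *)
Lemma central_binom_le j : pi * (j%:R * central_binom j ^+ 2) <= 1.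
Proof.
case: j => [|j]; first by rewrite mul0r mulr0 ler01.
have := wallis_noninc j.*2.+1.
rewrite -doubleS wallis_double wallis_doubleS => h.
have c0 := central_binom_gt0 j.
have d0 : 0 < j.*2.+1%:R * central_binom j by rewrite mulr_gt0// ltr0n.
move: h; rewrite -(ler_pM2r d0) mulVf ?gt_eqF// => h.
(* This turns the product of two consecutive coefficients into a square. *)
have e : j.*2.+1%:R * central_binom j = j.*2.+2%:R * central_binom j.+1.
  by rewrite central_binomS; field; rewrite -!natrD !pnatr_eq0.
apply: le_trans h; rewrite e -doubleS -muln2 natrM le_eqVlt; apply/orP; left.
by apply/eqP; field.
Qed.

End wallis.

(** * Near-coincidence of two independent Poisson variables *)

Section poisson_collision.
Context {R : realType}.
Implicit Types lam : R.

Let b (s : nat) : R := s%:R / 2 * central_binom s./2.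

Lemma central_binom_sqr_bound s : `|pi * b s ^+ 2 - s%:R / 2| <= pi.
Proof.
have pi2 := @pi_ge2 R.
rewrite /b -[in s%:R](odd_double_half s); move: (s./2) => j.
have := central_binom_ge (R := R) j; have := central_binom_le (R := R) j.
have := ltW (central_binom_gt0 (R := R) j).
have := central_binom_le1 (R := R) j.
rewrite natrD -[j.*2.+1%:R]natr1 -muln2 natrM.
move: (central_binom j) => r; set x : R := j%:R => r1 r0 h1 h2.
have x0 : 0 <= x by rewrite ler0n.
have r2 : pi * r ^+ 2 <= pi by rewrite ler_piMr ?pi_ge0// expr2 mulr_ile1.
have r20 : 0 <= pi * r ^+ 2 by rewrite mulr_ge0 ?pi_ge0 ?sqr_ge0.
rewrite exprMn; move: h1 h2; rewrite (mulrCA pi x) (mulrCA pi (x * 2 + 1)).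
rewrite (mulrCA pi (_ ^+ 2)).
move: (pi * r ^+ 2) r2 r20 => y r2 r20 h1 h2.
have xy : 0 <= x * y by rewrite mulr_ge0.
have xxy : x * (x * y) <= x by rewrite ler_piMr.
(* With [s = 2x] or [s = 2x + 1] and [y = pi * r ^+ 2], Wallis' bounds read [x * y <= 1] and
   [2 <= (2x + 1) * y]; both cases are polynomial inequalities in [x] and [y]. *)
rewrite ler_norml; case: (odd s) => /=.
- rewrite (_ : _ - _ = (2 * x + 1) / 4 * ((x * 2 + 1) * y - 2)); last by field.
  have h3 : 0 <= (2 * x + 1) / 4 * ((x * 2 + 1) * y - 2).
    by rewrite mulr_ge0 ?divr_ge0 ?subr_ge0// addr_ge0// mulr_ge0.
  by apply/andP; split; [lra | nra].
- have h3 : 0 <= x * (x * y + y / 2 - 1) by rewrite mulr_ge0//; lra.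
  by apply/andP; split; nra.
Qed.

(** Given that two independent Poisson variables of mean [lam] sum to [2k], each is binomial of
    parameter 1/2, and both equal [k] with probability [central_binom k]. *)
Lemma central_binom_poisson lam k :
  central_binom k * poisson_weight (2 * lam) k.*2 = poisson_weight lam k ^+ 2.
Proof.
rewrite /poisson_weight /central_binom.
rewrite (_ : - (2 * lam) = - lam + - lam); last by ring.
rewrite [(2 * _) ^+ _]exprMn.
have -> : 2 ^+ k.*2 = 4 ^+ k :> R.
  by rewrite -mul2n exprM (_ : 2 ^+ 2 = 4)//; ring.
rewrite expRD -muln2 exprM.
by field; rewrite !fact_neq0 expf_neq0.
Qed.

(** The values [k] and [k + 1], given the sum [2k + 1], have probability
    ['C(2k + 1, k) / 2 ^ (2k + 1)], which is [central_binom k.+1]. *)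
Lemma central_binom_poissonS lam k :
  central_binom k.+1 * poisson_weight (2 * lam) k.*2.+1 =
  poisson_weight lam k * poisson_weight lam k.+1.
Proof.
have k0 : k.+1%:R != 0 :> R by rewrite pnatr_eq0.
apply: (mulfI k0); rewrite central_binomS mulrCA [RHS]mulrCA poisson_weightS.
rewrite mulrCA.
have -> : k.+1%:R * (central_binom k * (k.*2.+1%:R / k.*2.+2%:R) *
    poisson_weight (2 * lam) k.*2.+1) =
  central_binom k / 2 * (k.*2.+1%:R * poisson_weight (2 * lam) k.*2.+1).
  by rewrite -doubleS -[k.+1.*2]muln2 natrM; field; rewrite nat1r pnatr_eq0.
rewrite poisson_weightS.
transitivity (lam * (central_binom k * poisson_weight (2 * lam) k.*2)).
  by field.
by rewrite central_binom_poisson expr2; ring.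
Qed.

Lemma poisson_collision lam : 0 < lam ->
  exists2 l, has_sum (fun k => poisson_weight lam k *
      (poisson_weight lam k + poisson_weight lam k.+1)) l &
    `|lam * l - Num.sqrt (lam / pi)| <= (Num.sqrt (lam / pi))^-1 + 1 + 2 * pi.
Proof.
move=> lam0.
pose v := poisson_weight (2 * lam).
have v0 k : 0 <= v k by rewrite poisson_weight_ge0// mulr_ge0// ltW.
(* [s.+1./2] is [k] for [s = 2k] and [k + 1] for [s = 2k + 1], so that these terms, taken in pairs,
   are the collision terms. *)
have [l hl _] : exists2 l, has_sum (fun s => central_binom s.+1./2 * v s) l & `|l| <= 1.
  apply: (has_sum_dominated _ (has_sum_poisson_weight (2 * lam))) => s.
  rewrite ger0_norm; last by apply: mulr_ge0 (v0 s); exact/ltW/central_binom_gt0.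
  by rewrite ler_piMl ?central_binom_le1// -/(v s) v0.
exists l.
  apply: (eq_has_sum _ (has_sum_pair hl)) => k.
  rewrite -doubleS doubleK /= uphalf_double central_binom_poisson.
  by rewrite central_binom_poissonS mulrDr expr2.
set c := Num.sqrt _.
have c0 : 0 < c by rewrite sqrtr_gt0 divr_gt0// pi_gt0.
have c2 : pi * c ^+ 2 = lam.
  by rewrite sqr_sqrtr ?divr_ge0 ?pi_ge0 ?(ltW lam0)// mulrC divfK// gt_eqF// pi_gt0.
(* Stein's identity at mean [2 * lam] absorbs the factor [lam] into [b]. *)
have hb : has_sum (fun s => b s * v s) (lam * l).
  have := has_sumZ 2^-1 (poisson_stein (2 * lam) (g := fun s => central_binom s./2) hl).
  rewrite (mulrA 2^-1) mulKf// => h.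
  by apply: (eq_has_sum _ h) => s; rewrite /b /v; ring.
have hc : has_sum (fun s => b s * v s - c * v s) (lam * l - c).
  rewrite -[in X in has_sum _ X](mulr1 c); apply: has_sumB hb _.
  exact/has_sumZ/has_sum_poisson_weight.
(* With [t = s - 2 * lam], this majorant combines [|b s - c| <= (1 + |t|) / c] and
   [|t| <= c + t ^+ 2 / c]. The variance [2 * lam] equals [2 * pi * c ^+ 2], whence the term
   [2 * pi]. *)
have hr : has_sum (fun s => (c^-1 + 1) * v s
    + c ^- 2 * ((s%:R - 2 * lam) ^+ 2 * v s)) (c^-1 + 1 + 2 * pi).
  have := has_sumD (has_sumZ (c^-1 + 1) (has_sum_poisson_weight (2 * lam)))
    (has_sumZ (c ^- 2) (poisson_variance (2 * lam))).
  rewrite mulr1 -[in X in _ * (2 * X)]c2 mulrCA [pi * _]mulrC mulKf//.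
  by rewrite expf_eq0 gt_eqF.
apply: (has_sum_norm_le _ hc hr) => s.
rewrite -mulrBl [c ^- 2 * _]mulrA -mulrDl normrM (ger0_norm (v0 s)) ler_wpM2r//.
have := central_binom_sqr_bound s.
have b0 : 0 <= b s by rewrite mulr_ge0 ?divr_ge0// ltW// central_binom_gt0.
have pi2 := @pi_ge2 R.
move: (b s) b0 => B B0 hB.
set t := s%:R - 2 * lam.
have ht : `|B ^+ 2 - c ^+ 2| <= 1 + `|t|.
  rewrite -(ler_pM2l (pi_gt0 R)) -[X in X * `|_|](ger0_norm (pi_ge0 R)) -normrM.
  rewrite (_ : pi * _ = (pi * B ^+ 2 - s%:R / 2) + t / 2); last first.
    by rewrite mulrBr c2 /t; field.
  apply: le_trans (ler_normD _ _) _; rewrite mulrDr mulr1 lerD//.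
  rewrite normrM mulrC ler_wpM2r// ger0_norm//; lra.
(* Since [B + c >= c], factoring the difference of squares gains a division by [c]. *)
have hc1 : c * `|B - c| <= 1 + `|t|.
  apply: le_trans ht; rewrite subr_sqr normrM mulrC ler_wpM2l//.
  by rewrite (le_trans _ (ler_norm _))// lerDr.
have h0 : 0 < c ^+ 2 by rewrite exprn_gt0.
rewrite -(ler_pM2l h0) !mulrDr mulr1 mulrA divff ?gt_eqF// mul1r.
rewrite expr2 -[c * c / c]mulrA divff ?gt_eqF// mulr1 -mulrA.
apply: le_trans (ler_wpM2l (ltW c0) hc1) _.
(* [`|t| <= c + t ^+ 2 / c] *)
rewrite -[t ^+ 2]real_normK ?num_real//.
have : 0 <= (`|t| - c) ^+ 2 by rewrite sqr_ge0.
nra.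
Qed.
End poisson_collision.

(** * Second-order Taylor bound valid on the whole line *)

Section taylor.
Context {R : realType}.

Lemma is_derive_linear_approx {f : R -> R} {x l : R} : is_derive x 1 f l ->
  forall e : R, 0 < e -> \forall y \near x, `|f y - f x - l * (y - x)| <= e * `|y - x|.
Proof.
move=> [df dfl] e e0.
have : h^-1 *: (f (h *: 1 + x) - f x) @[h --> 0^'] --> l.
  by rewrite -dfl; exact: df.
move=> /cvgrPdist_le /(_ e e0) /nbhs_ballP[d /= d0 hd].
apply/nbhs_ballP; exists d => // y; rewrite /ball /= => yd.
have [->|yx] := eqVneq y x; first by rewrite !subrr mulr0 subr0 normr0 mulr0.
have yx0 : y - x != 0 by rewrite subr_eq0.
rewrite distrC in yd.
have := hd (y - x); rewrite /ball /= sub0r normrN => /(_ yd yx0).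
rewrite -(ler_pM2r (x := `|y - x|)) ?normr_gt0// -normrM.
rewrite /GRing.scale /= mulr1 subrK mulrBl mulrAC mulVf// mul1r.
by move=> h; rewrite distrC.
Qed.

(** Mean value theorem with no order imposed on [x] and [y]: distances to [x] replace intervals. *)
Lemma mvt_dist {g dg : R -> R} {x y : R} :
  (forall z, `|z - x| <= `|y - x| -> is_derive z 1 g (dg z)) ->
  exists2 c, `|c - x| <= `|y - x| & g y - g x = dg c * (y - x).
Proof.
move=> gdg.
have h : forall a b : R, a <= b -> (forall z, a <= z <= b -> is_derive z 1 g (dg z)) ->
    exists2 c, a <= c <= b & g b - g a = dg c * (b - a).
  move=> a b ab abg.
  have [||c cab e] := @MVT_segment R g dg a b ab _ _.
  - by move=> z; rewrite in_itv /= => /andP[az zb]; apply: abg; rewrite !ltW.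
  - apply: derivable_within_continuous => z; rewrite in_itv /= => /abg gz.
    by have [] := gz.
  - by exists c => //; rewrite in_itv /= in cab.
have [xy|/ltW yx] := leP x y.
  have [z /andP[xz zy]|c /andP[xc cy] e] := h _ _ xy.
    by apply: gdg; rewrite !ger0_norm ?subr_ge0// lerB.
  by exists c => //; rewrite !ger0_norm ?subr_ge0// lerB.
have [z /andP[xz zy]|c /andP[xc cy] e] := h _ _ yx.
  by apply: gdg; rewrite !ler0_norm ?subr_le0// lerN2 lerB.
exists c; first by rewrite !ler0_norm ?subr_le0// lerN2 lerB.
by rewrite -[LHS]opprB e; ring.
Qed.

(** Near [x], the mean value theorem applies to the remainder, whose derivative is at most
    [e * |t - x|]. Away from [x], as [F] varies by at most 1, a multiple of [(y - x) ^+ 4] absorbs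
    everything; the fourth central moment of [N / m] being [O(m ^ -2)], this is harmless after
    averaging. *)
Lemma taylor2_bound {F f : R -> R} {x l : R} : 0 < x ->
  (forall y : R, 0 < y -> is_derive y 1 F (f y)) -> is_derive x 1 f l ->
  (forall y, `|F y - F x| <= 1) ->
  forall e : R, 0 < e -> exists2 K, 0 <= K & forall y,
    `|F y - F x - f x * (y - x) - l / 2 * (y - x) ^+ 2| <=
      e * (y - x) ^+ 2 + K * (y - x) ^+ 4.
Proof.
move=> x0 Ff fl F1 e e0.
have [d /= d0 hd] : exists2 d, 0 < d & forall y : R, `|y - x| < d ->
    0 < y /\ `|f y - f x - l * (y - x)| <= e * `|y - x|.
  have /nbhs_ballP[d /= d0 hd] : \forall y \near x,
      0 < y /\ `|f y - f x - l * (y - x)| <= e * `|y - x|.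
    near=> y; split; first by near: y; exact: lt_nbhsr.
    by near: y; exact: is_derive_linear_approx.
  by exists d => // y yd; apply: hd; rewrite /ball /= distrC.
(* For [|z| >= d], each power of [|z| / d] is at least 1: the exponents of [d] complete the degree
   of each term to 4. *)
exists (d ^- 4 + `|f x| * d ^- 3 + `|l / 2| * d ^- 2).
  by rewrite !addr_ge0// ?mulr_ge0 ?invr_ge0 ?exprn_ge0// ltW.
move=> y; set z := y - x.
have [zd|dz] := ltP `|z| d.
  rewrite ler_wpDr//.
    by rewrite mulr_ge0 ?exprn_even_ge0// !addr_ge0// ?mulr_ge0 ?invr_ge0 ?exprn_ge0// ltW.
  pose g t := F t - F x - f x * (t - x) - l / 2 * (t - x) ^+ 2.
  have [t tz|c cz] := @mvt_dist g (fun t => f t - f x - l * (t - x)) x y.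
    have [t0 _] := hd _ (le_lt_trans tz zd).
    have ? := Ff _ t0.
    have -> : g = F - cst (F x) - f x *: (id - cst x)
        - (l / 2) *: (id - cst x) ^+ 2.
      by apply/funext => u; rewrite /g !fctE.
    apply: is_derive_eq; rewrite !fctE /GRing.scale /=.
    by field.
  have -> : g x = 0 by rewrite /g !subrr expr0n !mulr0 !subr0.
  rewrite subr0 -[F y - F x - _ - _]/(g y) => ->.
  have [_ hc] := hd _ (le_lt_trans cz zd).
  rewrite normrM -[z ^+ 2]real_normK ?num_real// expr2 mulrA ler_wpM2r//.
  by rewrite (le_trans hc)// ler_wpM2l// ltW.
apply: (@le_trans _ _ (1 + `|f x| * `|z| + `|l / 2| * `|z| ^+ 2)).
  rewrite (le_trans (ler_normB _ _))// lerD//; last by rewrite normrM normrX.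
  rewrite (le_trans (ler_normB _ _))// lerD// ?normrM//.
rewrite ler_wpDl//; first by rewrite (mulr_ge0 (ltW e0)) ?sqr_ge0.
rewrite -[z ^+ 4]ger0_norm ?exprn_even_ge0// normrX !mulrDl.
move: `|z| dz => u du; have u0 : 0 < u by exact: lt_le_trans du.
have h k j : u ^+ k <= d ^- j * u ^+ (k + j).
  rewrite exprD mulrCA ler_peMr ?exprn_ge0 ?(ltW u0)//.
  rewrite mulrC ler_pdivlMr ?exprn_gt0// mul1r.
  by rewrite lerXn2r// nnegrE ltW.
rewrite -!mulrA !lerD//.
- exact: (h 0%N 4%N).
- by rewrite ler_wpM2l//; exact: (h 1%N 3%N).
- by rewrite ler_wpM2l//; exact: (h 2%N 2%N).
Unshelve. all: by end_near. Qed.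

End taylor.

(** * Asymptotics of the Szasz means of [F] *)

Section szasz_expansion.
Context {R : realType}.
Variables (F f : R -> R) (x l : R).
Hypotheses (x0 : 0 < x) (F01 : forall y, 0 <= F y <= 1).
Hypotheses (Ff : forall y : R, 0 < y -> is_derive y 1 F (f y))
  (fl : is_derive x 1 f l).

(** The expectation of [F (N / m)] for [N] Poisson of mean [m * x]: the Szasz operator applied to
    [F]. *)
Definition szasz_mean m :=
  limn (series (fun k => F (k%:R / m) * poisson_weight (m * x) k)).

(* The expectation of [F] at the minimum of two independent copies of the
   rescaled Poisson variable of [szasz_mean]. *)
Definition szasz_min_mean m :=
  limn (series (fun k => F (k%:R / m) * poisson_min_weight (m * x) k)).

Let mx0 (m : R) : 0 < m -> 0 <= m * x.
Proof. by move=> m0; rewrite ltW// mulr_gt0. Qed.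

Lemma has_sum_szasz_mean m : 0 < m ->
  has_sum (fun k => F (k%:R / m) * poisson_weight (m * x) k) (szasz_mean m).
Proof.
move=> /mx0 m0.
suff h k : `|F (k%:R / m) * poisson_weight (m * x) k| <= poisson_weight (m * x) k.
  have [k kF _] := has_sum_dominated h (has_sum_poisson_weight (m * x)).
  by rewrite /szasz_mean (has_sum_lim kF).
have /andP[F0 F1] := F01 (k%:R / m); have v0 := poisson_weight_ge0 (m * x) k m0.
by rewrite ger0_norm ?(mulr_ge0 F0 v0)// ler_piMl.
Qed.

Lemma has_sum_szasz_min_mean m : 0 < m ->
  has_sum (fun k => F (k%:R / m) * poisson_min_weight (m * x) k)
    (szasz_min_mean m).
Proof.
move=> /mx0 m0.
suff h k : `|F (k%:R / m) * poisson_min_weight (m * x) k| <= poisson_min_weight (m * x) k.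
  have [k kF _] := has_sum_dominated h (has_sum_poisson_min_weight (m * x)).
  by rewrite /szasz_min_mean (has_sum_lim kF).
have /andP[F0 F1] := F01 (k%:R / m).
have v0 := poisson_min_weight_ge0 (m * x) k m0.
by rewrite ger0_norm ?(mulr_ge0 F0 v0)// ler_piMl.
Qed.

Lemma szasz_moment1 m : 0 < m ->
  has_sum (fun k => (k%:R / m - x) * poisson_weight (m * x) k) 0.
Proof.
move=> m0; have := has_sumB (has_sumZ m^-1 (poisson_moment1 (m * x)))
  (has_sumZ x (has_sum_poisson_weight (m * x))).
rewrite mulr1 mulKf ?gt_eqF// subrr.
by apply: (eq_has_sum _) => k; rewrite mulrA -mulrBl [m^-1 * _]mulrC.
Qed.

Lemma szasz_moment2 m : 0 < m ->
  has_sum (fun k => (k%:R / m - x) ^+ 2 * poisson_weight (m * x) k) (x / m).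
Proof.
move=> m0; have := has_sumZ (m ^- 2) (poisson_variance (m * x)).
rewrite (_ : _ * (m * x) = x / m); last by field; rewrite gt_eqF.
by apply: (eq_has_sum _) => k; field; rewrite gt_eqF.
Qed.

Lemma szasz_moment4 m : 0 < m ->
  has_sum (fun k => (k%:R / m - x) ^+ 4 * poisson_weight (m * x) k)
    (3 * x ^+ 2 / m ^+ 2 + x / m ^+ 3).
Proof.
move=> m0; have := has_sumZ (m ^- 4) (poisson_central_moment4 (m * x)).
rewrite [X in has_sum _ X](_ : _ = 3 * x ^+ 2 / m ^+ 2 + x / m ^+ 3).
  by apply: (eq_has_sum _) => k; field; rewrite gt_eqF.
by field; rewrite gt_eqF.
Qed.

Let F1 y : `|F y - F x| <= 1.
Proof.
have /andP[? ?] := F01 x; have /andP[? ?] := F01 y.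
by rewrite ler_norml; apply/andP; split; lra.
Qed.

(** The Taylor bound is averaged over [N / m]: the linear term vanishes as the mean is [x], and the
    variance [x / m] produces the bias. *)
Lemma szasz_bias_bound e : 0 < e -> exists2 K, 0 <= K & forall m : R, 0 < m ->
  `|szasz_mean m - F x - l * x / 2 / m| <=
  e * (x / m) + K * (3 * x ^+ 2 / m ^+ 2 + x / m ^+ 3).
Proof.
move=> e0; have [K K0 hK] := taylor2_bound x0 Ff fl F1 _ e0.
exists K => // m m0.
have h := has_sumB (has_sumB (has_sumB (has_sum_szasz_mean _ m0)
  (has_sumZ (F x) (has_sum_poisson_weight (m * x))))
  (has_sumZ (f x) (szasz_moment1 _ m0)))
  (has_sumZ (l / 2) (szasz_moment2 _ m0)).
have h2 := has_sumD (has_sumZ e (szasz_moment2 _ m0))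
  (has_sumZ K (szasz_moment4 _ m0)).
rewrite (_ : _ - _ - _ = szasz_mean m - F x * 1 - f x * 0 - l / 2 * (x / m));
  last by field; rewrite gt_eqF.
apply: (has_sum_norm_le _ h h2) => k.
have v0 := poisson_weight_ge0 (m * x) k (mx0 _ m0).
have hk := ler_wpM2r v0 (hK (k%:R / m)); rewrite -{1}(ger0_norm v0) -normrM in hk.
apply: le_trans (le_trans hk _); rewrite le_eqVlt; apply/orP; left; apply/eqP.
  by congr `|_|; ring.
by ring.
Qed.

Lemma szasz_bias_cvg : m * (szasz_mean m - F x) @[m --> pinfty_nbhs R] --> l * x / 2.
Proof.
apply/cvgrPdist_le => e e0.
(* Two error terms get [e / 2] each: this choice settles the quadratic one, large [m] the quartic
   one. *)
have e'0 : 0 < e / 2 / x by rewrite !divr_gt0.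
have [K K0 hK] := szasz_bias_bound _ e'0.
set C := K * (3 * x ^+ 2 + x).
have C0 : 0 <= C by rewrite mulr_ge0// addr_ge0 ?mulr_ge0 ?sqr_ge0 ?ltW.
near=> m.
have m1 : 1 <= m by near: m; apply: nbhs_pinfty_ge; exact: num_real.
have m0 : 0 < m by rewrite (lt_le_trans ltr01).
have Cm : C / m <= e / 2.
  by rewrite ler_pdivrMr// -ler_pdivrMl ?divr_gt0//.
rewrite distrC (_ : _ - _ = m * (szasz_mean m - F x - l * x / 2 / m)); last first.
  by field; rewrite gt_eqF.
rewrite normrM (gtr0_norm m0) (le_trans (ler_wpM2l (ltW m0) (hK _ m0)))//.
rewrite (_ : m * _ = e / 2 + K * (3 * x ^+ 2 + x / m) / m); last first.
  by field; rewrite !gt_eqF.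
rewrite [leRHS]splitr lerD2l (le_trans _ Cm)//.
rewrite ler_wpM2r ?invr_ge0 ?(ltW m0)// ler_wpM2l// lerD2l ler_pdivrMr//.
by rewrite ler_peMr// ltW.
Unshelve. all: by end_near. Qed.

Let moment4_le m : 1 <= m ->
  3 * x ^+ 2 / m ^+ 2 + x / m ^+ 3 <= (3 * x ^+ 2 + x) / m.
Proof.
move=> m1; have m0 : 0 < m by rewrite (lt_le_trans ltr01).
have x20 : 0 <= 3 * x ^+ 2 by rewrite mulr_ge0// sqr_ge0.
have mV n : m ^- n.+1 <= m^-1 by rewrite lef_pV2 ?posrE ?exprn_gt0// ler_eXnr.
by rewrite [leRHS]mulrDl lerD ?ler_wpM2l// ltW.
Qed.

Lemma szasz_mean_bound : exists2 K, 0 <= K & forall m : R, 1 <= m ->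
  `|szasz_mean m - F x| <= K / m.
Proof.
have [K K0 hK] := szasz_bias_bound _ ltr01.
exists (x + K * (3 * x ^+ 2 + x) + `|l * x / 2|).
  by rewrite !addr_ge0// ?(ltW x0)// mulr_ge0// addr_ge0 ?mulr_ge0 ?sqr_ge0 ?ltW.
move=> m m1; have m0 : 0 < m by rewrite (lt_le_trans ltr01).
rewrite -(subrK (l * x / 2 / m) (_ - _)) (le_trans (ler_normD _ _))//.
rewrite [leRHS]mulrDl lerD//; last first.
  by rewrite normrM (gtr0_norm (_ : 0 < m^-1)) ?invr_gt0.
rewrite (le_trans (hK _ m0))// mul1r [leRHS]mulrDl lerD// -[leRHS]mulrA ler_wpM2l//.
exact: moment4_le.
Qed.

(** First-order expansion under the law of the minimum: the quadratic and quartic errors are at most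
    twice the Poisson ones, and the linear term is given by the collision estimate. *)
Lemma szasz_min_mean_bound : exists2 K, 0 <= K & forall m : R, 1 <= m ->
  `|szasz_min_mean m - F x + (Num.sqrt m)^-1 * (f x * Num.sqrt (x / pi))| <= K / m.
Proof.
have [K K0 hK] := taylor2_bound x0 Ff fl F1 _ ltr01.
have s0 : 0 < Num.sqrt (x / pi) by rewrite sqrtr_gt0 divr_gt0// pi_gt0.
set s := Num.sqrt (x / pi) in s0 *.
(* [C1] bounds the Taylor error, with the factor 2 of [poisson_min_weight_le]; [C2] bounds the
   collision error for all [m >= 1], where [Num.sqrt (m * x / pi) >= s]. *)
set C1 := 2 * ((1 + `|l / 2|) * x + K * (3 * x ^+ 2 + x)).
set C2 := s^-1 + 1 + 2 * pi.
have C10 : 0 <= C1.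
  have h : 0 <= 3 * x ^+ 2 + x by rewrite addr_ge0// ?(ltW x0)// mulr_ge0// sqr_ge0.
  apply: mulr_ge0 => //; apply: addr_ge0; apply: mulr_ge0 => //.
  exact: ltW.
have C20 : 0 <= C2.
  rewrite !addr_ge0 ?invr_ge0 ?(ltW s0)//; apply: mulr_ge0 => //; exact: pi_ge0.
exists (C1 + `|f x| * C2); first by apply: addr_ge0 => //; exact: mulr_ge0.
move=> m m1; have m0 : 0 < m by rewrite (lt_le_trans ltr01).
have lam0 : 0 < m * x by rewrite mulr_gt0.
have [t ht hts] := poisson_collision _ lam0.
have hmin := poisson_min_moment1 ht.
have h := has_sumB (has_sum_szasz_min_mean _ m0)
  (has_sumD (has_sumZ (F x - f x * x) (has_sum_poisson_min_weight (m * x)))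
     (has_sumZ (f x / m) hmin)).
have h2 := has_sumZ 2 (has_sumD (has_sumZ (1 + `|l / 2|) (szasz_moment2 _ m0))
  (has_sumZ K (szasz_moment4 _ m0))).
(* The Taylor error comes first, then the collision error. *)
rewrite (_ : _ + _ = (szasz_min_mean m -
   ((F x - f x * x) * 1 + f x / m * (m * x * (1 - t))))
   - f x * ((m * x * t - Num.sqrt (m * x / pi)) / m)); last first.
  have -> : Num.sqrt (m * x / pi) = Num.sqrt m * s by rewrite -mulrA sqrtrM// ltW.
  have r0 : 0 < Num.sqrt m by rewrite sqrtr_gt0.
  move: (szasz_min_mean m) (Num.sqrt m) r0 (sqr_sqrtr (ltW m0)) => A r r0 <-.
  by field; rewrite gt_eqF.
rewrite (le_trans (ler_normB _ _))// [leRHS]mulrDl lerD//.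
  apply: (le_trans (has_sum_norm_le _ h h2)) => [k|].
    have v0 := poisson_weight_ge0 (m * x) k (ltW lam0).
    have u0 := poisson_min_weight_ge0 (m * x) k (ltW lam0).
    have u1 := poisson_min_weight_le (m * x) k (ltW lam0).
    set z := k%:R / m - x.
    rewrite (_ : _ - _ = (F (k%:R / m) - F x - f x * z) * poisson_min_weight (m * x) k);
      last by rewrite /z; ring.
    rewrite normrM (ger0_norm u0).
    rewrite (_ : 2 * _ =
      ((1 + `|l / 2|) * z ^+ 2 + K * z ^+ 4) * (2 * poisson_weight (m * x) k));
      last by ring.
    apply: ler_pM => //.
    have := hK (k%:R / m); rewrite -/z mul1r => hk.
    rewrite -(subrK (l / 2 * z ^+ 2) (_ - _ - _)) (le_trans (ler_normD _ _))//.
    by rewrite mulrDl mul1r [leRHS]addrAC lerD// normrM (ger0_norm (sqr_ge0 z)).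
  rewrite (_ : C1 / m = 2 * ((1 + `|l / 2|) * (x / m) + K * ((3 * x ^+ 2 + x) / m))).
    by rewrite ler_pM2l// lerD2l ler_wpM2l//; exact: moment4_le.
  by rewrite /C1; ring.
rewrite normrM -[leRHS]mulrA ler_wpM2l// normrM (gtr0_norm (_ : 0 < m^-1)) ?invr_gt0//.
rewrite ler_wpM2r ?invr_ge0 ?(ltW m0)// (le_trans hts)// /C2 !lerD2r.
rewrite lef_pV2 ?posrE ?sqrtr_gt0 ?divr_gt0 ?pi_gt0//.
rewrite ler_wsqrtr// ler_pM2r ?invr_gt0 ?pi_gt0//.
by rewrite ler_peMl// ltW.
Qed.
End szasz_expansion.

(** * Expectations of bounded random variables *)

Section bounded_measurable.
Context {d} {T : measurableType d} {R : realType} (P : probability T R).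
Implicit Types f g : T -> R.

(** A class closed under sums and products in which integrability is automatic, so that expectations
    are linear without side conditions. *)
Definition bounded_measurable f :=
  measurable_fun setT f /\ exists M, forall w, `|f w| <= M.

Lemma bounded_measurable_integrable {f} :
  bounded_measurable f -> P.-integrable setT (EFin \o f).
Proof.
move=> [mf [M fM]]; apply: measurable_bounded_integrable => //.
  by rewrite (le_lt_trans (probability_le1 _ _))// ltry.
by exists M; split; [exact: num_real | move=> N /ltW MN w _; exact: le_trans MN].
Qed.

Lemma bounded_measurable_cst c : bounded_measurable (cst c).
Proof. by split=> //; exists `|c|. Qed.

Lemma bounded_measurableD {f g} : bounded_measurable f ->
  bounded_measurable g -> bounded_measurable (fun w => f w + g w).
Proof.
move=> [mf [M fM]] [mg [N gN]]; split; first exact: measurable_funD.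
by exists (M + N) => w; rewrite (le_trans (ler_normD _ _))// lerD.
Qed.

Lemma bounded_measurableM {f g} : bounded_measurable f ->
  bounded_measurable g -> bounded_measurable (fun w => f w * g w).
Proof.
move=> [mf [M fM]] [mg [N gN]]; split; first exact: measurable_funM.
by exists (M * N) => w; rewrite normrM ler_pM.
Qed.

Lemma bounded_measurable_sum {I : Type} (r : seq I) {f : I -> T -> R} :
  (forall i, bounded_measurable (f i)) ->
  bounded_measurable (fun w => \sum_(i <- r) f i w).
Proof.
move=> bf; elim: r => [|i r IH].
  under eq_fun do rewrite big_nil; exact: bounded_measurable_cst.
by under eq_fun do rewrite big_cons; exact: bounded_measurableD.
Qed.

Lemma RexpectationD {f g} : bounded_measurable f -> bounded_measurable g ->
  \int[P]_w (f w + g w) = \int[P]_w f w + \int[P]_w g w.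
Proof. by move=> bf bg; rewrite RintegralD//; exact: bounded_measurable_integrable. Qed.

Lemma RexpectationZ c {f} : bounded_measurable f ->
  \int[P]_w (c * f w) = c * \int[P]_w f w.
Proof. by move=> bf; rewrite RintegralZl//; exact: bounded_measurable_integrable. Qed.

Lemma Rexpectation_cst c : \int[P]_w c = c.
Proof.
transitivity (c * fine (P setT)); first exact: Rintegral_cst.
by rewrite probability_setT mulr1.
Qed.

Lemma Rexpectation_sum {I : Type} (r : seq I) {f : I -> T -> R} :
  (forall i, bounded_measurable (f i)) ->
  \int[P]_w (\sum_(i <- r) f i w) = \sum_(i <- r) \int[P]_w f i w.
Proof.
move=> bf; elim: r => [|i r IH].
  by rewrite big_nil; under eq_Rintegral do rewrite big_nil; rewrite Rexpectation_cst.
under eq_Rintegral do rewrite big_cons.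
by rewrite big_cons RexpectationD ?IH//; exact: bounded_measurable_sum.
Qed.

Lemma Rexpectation_cvg {f : nat -> T -> R} {g M} :
  (forall n, measurable_fun setT (f n)) -> (forall n w, `|f n w| <= M) ->
  (forall w, f n w @[n --> \oo] --> g w) ->
  bounded_measurable g /\ \int[P]_w f n w @[n --> \oo] --> \int[P]_w g w.
Proof.
move=> mf fM fg.
have bg : bounded_measurable g.
  split; first by apply: (measurable_fun_cvg mf) => w _; exact: fg.
  exists M => w; apply: (ler_cvg_to (cvg_norm (fg w)) (cvg_cst M)).
  by near=> n.
split=> //.
have [||||| _ _ h] := @dominated_convergence _ T R P setT measurableT
  (fun n w => (f n w)%:E) (EFin \o g) (cst M%:E).
- by move=> n; exact/measurable_EFinP.
- by apply/measurable_EFinP; case: bg.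
- by apply: aeW => w _; apply: cvg_EFin; [exact: nearW | exact: fg].
- exact: finite_measure_integrable_cst.
- by apply: aeW => w n _; rewrite lee_fin.
- apply: fine_cvg; rewrite fineK//.
  by apply: integrable_fin_num => //; exact: bounded_measurable_integrable.
Unshelve. all: by end_near. Qed.

(** Series and expectation are exchanged by bounded convergence, the partial sums lying in [[0, s]].
    The factor [Z] serves for products of two terms. *)
Lemma Rexpectation_has_sum {Z : T -> R} {a : nat -> T -> R} {c s Y} :
  bounded_measurable Z ->
  (forall k, measurable_fun setT (a k)) -> (forall k w, 0 <= a k w <= 1) ->
  (forall k, 0 <= c k) -> has_sum c s ->
  (forall w, has_sum (fun k => a k w * c k) (Y w)) ->
  bounded_measurable Y /\
  has_sum (fun k => (\int[P]_w (Z w * a k w)) * c k) (\int[P]_w (Z w * Y w)).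
Proof.
move=> bZ ma a01 c0 cs aY.
have ba k : bounded_measurable (a k).
  split=> //; exists 1 => w; have /andP[h0 h1] := a01 k w.
  by rewrite ger0_norm.
pose S n w := series (fun k => a k w * c k) n.
have S0 n w : 0 <= S n w.
  by apply: sumr_ge0 => k _; apply: mulr_ge0 => //; case/andP: (a01 k w).
have Ss n w : `|S n w| <= s.
  rewrite ger0_norm// (le_trans _ (has_sum_partial_le n c0 cs))//.
  rewrite /S /series /= big_mkord ler_sum// => k _.
  by rewrite ler_piMl//; case/andP: (a01 k w).
have bS n : bounded_measurable (S n).
  apply: bounded_measurable_sum => k; apply: bounded_measurableM => //.
  exact: bounded_measurable_cst.
have [bY _] := Rexpectation_cvg (fun n => (bS n).1) Ss aY.
split=> //.
have [mZ [M ZM]] := bZ.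
have ZS n w : `|Z w * S n w| <= M * s by rewrite normrM ler_pM.
have ZY w : Z w * S n w @[n --> \oo] --> Z w * Y w by exact: cvgMl_tmp (aY w).
have [_ h] := Rexpectation_cvg (fun n => (bounded_measurableM bZ (bS n)).1) ZS ZY.
rewrite /has_sum (_ : series _ = fun n => \int[P]_w (Z w * S n w))//.
apply/funext => n; rewrite /series /= /S /series /=.
under [RHS]eq_Rintegral do rewrite mulr_sumr.
rewrite [RHS]Rexpectation_sum => [|k].
  apply: eq_bigr => k _; rewrite mulrC -RexpectationZ ?bounded_measurableM//.
    by apply: eq_Rintegral => w _; ring.
  exact: bounded_measurableM.
do 2 apply: bounded_measurableM => //.
exact: bounded_measurable_cst.
Qed.

Lemma expectation_Rintegral f : fine 'E_P[f] = \int[P]_w f w.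
Proof. by rewrite unlock. Qed.

Lemma Rexpectation_indic (A : set T) : measurable A ->
  \int[P]_w \1_A w = fine (P A).
Proof. by move=> mA; rewrite /Rintegral integral_indic// setIT. Qed.

End bounded_measurable.

(** * Squares of Poisson tail probabilities *)

Section poisson_filter.
Context {R : realType}.

(** Two variables both lie in a final segment exactly when their minimum does. If the segment starts
    at [a] and [T] is the tail, the partial sums for [n >= a] are [T_a ^ 2 - T_n ^ 2 = S_n * (S_n +
    2 * T_n)] with [S_n = T_a - T_n]. *)
Lemma has_sum_filter_sqr {lam : R} {p : nat -> bool} {y} :
  (forall k, p k -> p k.+1) ->
  has_sum (fun k => (p k)%:R * poisson_weight lam k) y ->
  has_sum (fun k => (p k)%:R * poisson_min_weight lam k) (y ^+ 2).
Proof.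
move=> pS hy.
pose S := series (fun k => (p k)%:R * poisson_weight lam k).
have S0 n : ~~ p n -> S n = 0.
  elim: n => [|n IH] pn; first by rewrite /S /series /= big_geq.
  have pn' : ~~ p n by apply: contra pn; exact: pS.
  by rewrite /S seriesSr /= -/(S n) IH// (negbTE pn') mul0r addr0.
(* Summation by parts, as [p] is the indicator of a final segment. *)
rewrite /has_sum (_ : series _ = S * (S + 2 *: poisson_tail lam)).
  have h : 2 *: poisson_tail lam @ \oo --> (0 : R).
    rewrite -(mulr0 2); exact: (cvgZl_tmp (k := 2) (poisson_tail_cvg0 lam)).
  rewrite expr2 -{2}(addr0 y); exact: cvgM hy (cvgD hy h).
apply/funext; elim=> [|n IH].
  by rewrite /S /series /= !fctE !big_geq// mul0r.
rewrite seriesSr IH !fctE /S seriesSr -/S /= /GRing.scale /= /poisson_min_weight.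
rewrite poisson_tailS; by have [pn|/S0 ->] := boolP (p n); rewrite /=; ring.
Qed.

End poisson_filter.

(** * Exact mean squared error of the estimator *)

Section szasz_mse.
Context {d} {T : measurableType d} {R : realType} (P : probability T R).
Variables (X : nat -> {RV P >-> R}) (F : R -> R).
Hypotheses (X_indep : mutually_independent X)
  (X_cdf : forall i y, cdf (X i) y = (F y)%:E).

Let ind i a w : R := (X i w <= a)%R%:R.

Let indE i a : ind i a = \1_(X i @^-1` `]-oo, a]).
Proof.
apply/funext => w; rewrite /ind indicE; congr ((nat_of_bool _)%:R); apply/idP/idP.
  by rewrite inE /= in_itv.
by rewrite inE /= in_itv.
Qed.

Let mX i a : measurable (X i @^-1` `]-oo, a]).
Proof. by rewrite -[X in measurable X]setTI; exact: measurable_funPT. Qed.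

Let mind i a : measurable_fun setT (ind i a).
Proof. by rewrite indE; exact: measurable_indic. Qed.

Let ind01 i a w : 0 <= ind i a w <= 1.
Proof. by rewrite /ind; case: (X i w <= a)%R; rewrite ?ler01 ?lexx. Qed.

Let bind i a : bounded_measurable (ind i a).
Proof.
split=> //; exists 1 => w; have /andP[h0 h1] := ind01 i a w.
by rewrite ger0_norm.
Qed.

Let PX i a : P (X i @^-1` `]-oo, a]) = (F a)%:E.
Proof. exact: X_cdf. Qed.

Let Eind i a : \int[P]_w ind i a w = F a.
Proof.
by rewrite indE Rexpectation_indic// PX.
Qed.

Let Eind2 (i j : nat) a b : i != j -> \int[P]_w (ind i a w * ind j b w) = F a * F b.
Proof.
move=> ij.
have -> : (fun w => ind i a w * ind j b w) =
    \1_(X i @^-1` `]-oo, a] `&` X j @^-1` `]-oo, b]).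
  by apply/funext => w; rewrite indicI !indE.
rewrite Rexpectation_indic; last exact: measurableI.
have ji : (j == i) = false by rewrite eq_sym (negbTE ij).
(* Mutual independence takes a set for every index; the finite set of [i] and [j] selects two of
   them. *)
pose c k := if k == i then a else b.
have := X_indep [fset i; j]%fset (fun k => `]-oo, c k]%classic)
  (fun k => measurable_itv _).
rewrite big_fsetU1/= ?inE// big_seq_fset1 !PX /c eqxx ji.
rewrite -EFinM => e; rewrite -[RHS]/(fine (F a * F b)%:E) -e.
congr (fine (P _)); apply/seteqP; split=> w /=.
  move=> [wi wj] k /=; rewrite !inE => /orP[]/eqP ->; first by rewrite eqxx.
  by rewrite ji.
move=> h; split.
  by have := h i; rewrite /= !inE eqxx => /(_ isT).
have := h j; rewrite /= !inE eqxx orbT => /(_ isT).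
by rewrite ji.
Qed.

Let F01 a : 0 <= F a <= 1.
Proof.
rewrite -(Eind 0%N) indE Rexpectation_indic// fine_ge0//=.
by rewrite -lee_fin fineK ?probability_le1// fin_num_measure.
Qed.

Variables (m x : R).
Hypotheses (m0 : 0 < m) (x0 : 0 < x).

Definition szasz_term i w : R :=
  limn (series (fun k => (X i w <= k%:R / m)%R%:R * poisson_weight (m * x) k)).

Let mx0 : 0 <= m * x. Proof. by rewrite ltW// mulr_gt0. Qed.

Lemma has_sum_szasz_term i w :
  has_sum (fun k => (X i w <= k%:R / m)%R%:R * poisson_weight (m * x) k)
    (szasz_term i w).
Proof.
suff h k : `|ind i (k%:R / m) w * poisson_weight (m * x) k| <=
    poisson_weight (m * x) k.
  have [t ht _] := has_sum_dominated h (has_sum_poisson_weight (m * x)).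
  by rewrite /szasz_term (has_sum_lim ht).
have v0 := poisson_weight_ge0 (m * x) k mx0.
have /andP[h0 h1] := ind01 i (k%:R / m) w.
by rewrite ger0_norm ?(mulr_ge0 h0 v0)// ler_piMl.
Qed.

Lemma szasz_estimatorE n w :
  szasz_estimator X m n x w = n%:R^-1 * \sum_(i < n) szasz_term i w.
Proof.
apply: has_sum_lim.
have := has_sumZ n%:R^-1
  (has_sum_big (index_enum 'I_n) (fun i : 'I_n => has_sum_szasz_term i w)).
apply: (eq_has_sum _) => k.
by rewrite /empirical_df -mulrA mulr_suml.
Qed.

(** The condition [X i w <= k / m] is monotone in [k], so the square is again a single series in the
    same indicators. *)
Lemma has_sum_szasz_term_sqr i w :
  has_sum (fun k => (X i w <= k%:R / m)%R%:R * poisson_min_weight (m * x) k)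
    (szasz_term i w ^+ 2).
Proof.
apply: (has_sum_filter_sqr _ (has_sum_szasz_term i w)) => k /le_trans; apply.
by rewrite ler_pM2r ?invr_gt0// ler_nat.
Qed.

(** [Z = 1] gives the mean of a term; [Z] an indicator, then a term, gives the mixed products. *)
Let term_sum {Z : T -> R} i : bounded_measurable Z ->
  bounded_measurable (szasz_term i) /\
  has_sum (fun k => (\int[P]_w (Z w * ind i (k%:R / m) w))
                    * poisson_weight (m * x) k)
    (\int[P]_w (Z w * szasz_term i w)).
Proof.
move=> bZ; apply: (Rexpectation_has_sum P bZ) (has_sum_poisson_weight (m * x)) _.
- by move=> k; exact: mind.
- by move=> k w; exact: ind01.
- by move=> k; exact: poisson_weight_ge0.
- exact: has_sum_szasz_term.
Qed.

Lemma bounded_measurable_szasz_term i : bounded_measurable (szasz_term i).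
Proof. by have [] := term_sum i (bounded_measurable_cst 0). Qed.

Lemma Rexpectation_szasz_term i :
  \int[P]_w szasz_term i w = szasz_mean F x m.
Proof.
have [_] := term_sum i (bounded_measurable_cst 1).
under eq_Rintegral do rewrite mul1r; move=> h; apply: has_sum_unique h _.
apply: (eq_has_sum _ (has_sum_szasz_mean F x x0 F01 m m0)) => k.
by under eq_Rintegral do rewrite mul1r; rewrite Eind.
Qed.

Lemma Rexpectation_szasz_term_sqr i :
  \int[P]_w (szasz_term i w * szasz_term i w) = szasz_min_mean F x m.
Proof.
have [_] := Rexpectation_has_sum P (bounded_measurable_cst 1)
  (fun k => mind i (k%:R / m)) (fun k => ind01 i _)
  (fun k => poisson_min_weight_ge0 _ k mx0) (has_sum_poisson_min_weight _)
  (has_sum_szasz_term_sqr i).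
under eq_Rintegral do rewrite mul1r expr2; move=> h; apply: has_sum_unique h _.
apply: (eq_has_sum _ (has_sum_szasz_min_mean F x x0 F01 m m0)) => k.
by under eq_Rintegral do rewrite mul1r; rewrite Eind.
Qed.

(** Independence passes from indicators to terms one series at a time, first for [i], then for
    [j]. *)
Lemma Rexpectation_szasz_term_mul i j : i != j ->
  \int[P]_w (szasz_term i w * szasz_term j w) = szasz_mean F x m ^+ 2.
Proof.
move=> ij; have hB := has_sum_szasz_mean F x x0 F01 m m0.
have h a : \int[P]_w (szasz_term i w * ind j a w) = szasz_mean F x m * F a.
  have [_] := term_sum i (bind j a).
  under eq_Rintegral do rewrite mulrC; move=> h; apply: has_sum_unique h _.
  rewrite (mulrC _ (F a)); apply: (eq_has_sum _ (has_sumZ (F a) hB)) => k.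
  by rewrite mulrA Eind2// eq_sym.
have [_ h2] := term_sum j (bounded_measurable_szasz_term i).
apply: has_sum_unique h2 _.
by apply: (eq_has_sum _ (has_sumZ _ hB)) => k; rewrite h mulrA.
Qed.

Lemma szasz_mseE n : (0 < n)%N -> szasz_mse X F m n x =
  n%:R^-1 * (szasz_min_mean F x m - szasz_mean F x m ^+ 2)
  + (szasz_mean F x m - F x) ^+ 2.
Proof.
move=> n0; rewrite /szasz_mse expectation_Rintegral.
set A := szasz_min_mean F x m; set B := szasz_mean F x m.
have bY := bounded_measurable_szasz_term.
have bYY i j := bounded_measurableM (bY i) (bY j).
have -> : (fun w => (szasz_estimator X m n x w - F x) ^+ 2) = (fun w =>
    n%:R^-1 ^+ 2 * (\sum_(i < n) \sum_(j < n) szasz_term i w * szasz_term j w) +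
    ((- (2 * F x * n%:R^-1)) * (\sum_(i < n) szasz_term i w) + F x ^+ 2)).
  apply/funext => w; rewrite szasz_estimatorE.
  under [X in _ = _ * X + _]eq_bigr do rewrite -mulr_sumr.
  by rewrite -mulr_suml; ring.
have bc c := bounded_measurable_cst (T := T) (R := R) c.
have b1 : bounded_measurable (fun w => \sum_(i < n) szasz_term i w).
  exact: bounded_measurable_sum.
have b2 : bounded_measurable
    (fun w => \sum_(i < n) \sum_(j < n) szasz_term i w * szasz_term j w).
  by apply: bounded_measurable_sum => i; exact: bounded_measurable_sum.
have b3 c := bounded_measurableM (bc c) b1.
have b4 c := bounded_measurableM (bc c) b2.
have b5 c e := bounded_measurableD (b3 c) (bc e).
have e1 : \int[P]_w (\sum_(i < n) szasz_term i w) = n%:R * B.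
  rewrite Rexpectation_sum => [|i]; last exact: bY.
  under eq_bigr do rewrite Rexpectation_szasz_term.
  by rewrite sumr_const card_ord mulr_natl.
(* Each row of the double sum has one diagonal term, of mean [A], and [n.-1] others, of mean
   [B ^+ 2]. *)
have e2 : \int[P]_w (\sum_(i < n) \sum_(j < n) szasz_term i w * szasz_term j w) =
    n%:R * (A + n.-1%:R * B ^+ 2).
  rewrite Rexpectation_sum => [|i]; last exact: bounded_measurable_sum.
  rewrite (eq_bigr (fun=> A + n.-1%:R * B ^+ 2)) => [|i _].
    by rewrite sumr_const card_ord !mulr_natl.
  rewrite Rexpectation_sum => [|j]; last exact: bYY.
  rewrite (bigD1 i)//= Rexpectation_szasz_term_sqr; congr (_ + _).
  rewrite (eq_bigr (fun=> B ^+ 2)) => [|j ji].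
    by rewrite sumr_const cardC1 card_ord mulr_natl.
  by rewrite Rexpectation_szasz_term_mul// eq_sym.
have lin c1 c2 c3 : \int[P]_w
    (c1 * (\sum_(i < n) \sum_(j < n) szasz_term i w * szasz_term j w) +
      (c2 * (\sum_(i < n) szasz_term i w) + c3)) =
    c1 * (n%:R * (A + n.-1%:R * B ^+ 2)) + (c2 * (n%:R * B) + c3).
  rewrite (RexpectationD P (b4 _) (b5 _ _)) (RexpectationD P (b3 _) (bc _)).
  by rewrite (RexpectationZ P _ b1) (RexpectationZ P _ b2) Rexpectation_cst e1 e2.
rewrite lin -subn1 natrB//.
by field; rewrite pnatr_eq0 -lt0n.
Qed.

End szasz_mse.

(** * Roots and powers with real exponents *)

Section powR.
Context {R : realType}.
Implicit Types m a p : R.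

Lemma powR_half m : 0 <= m -> m `^ (1 / 2) = Num.sqrt m.
Proof. by move=> m0; rewrite div1r powR12_sqrt. Qed.

Lemma powR_rootn_exprn n a : 0 <= a -> (a `^ (1 / n.+1%:R)) ^+ n.+1 = a.
Proof.
move=> a0; rewrite -powR_mulrn ?powR_ge0// -powRrM mul1r mulVf ?pnatr_eq0//.
by rewrite powRr1.
Qed.

Lemma powR_exprn_rootn n a : 0 <= a -> (a ^+ n.+1) `^ (1 / n.+1%:R) = a.
Proof.
by move=> a0; rewrite -powR_mulrn// powRAC powR_mulrn ?powR_ge0// powR_rootn_exprn.
Qed.

Lemma powR_div_exprn n a p : 0 <= a -> a `^ (n%:R / p) = (a `^ (1 / p)) ^+ n.
Proof.
by move=> a0; rewrite -powR_mulrn ?powR_ge0// -powRrM div1r mulrC.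
Qed.

Lemma powRN_halfE {m} : 0 < m -> m `^ (- (1 / 2)) = (Num.sqrt m)^-1.
Proof. by move=> m1; rewrite powRN powR_half// ltW. Qed.

(** This makes the leading part a quartic polynomial in [t = m ^ (-1/2)]. *)
Lemma powRN2E {m} : 0 < m -> m `^ (- 2) = (m `^ (- (1 / 2))) ^+ 4.
Proof.
move=> m1; rewrite -powR_mulrn ?powR_ge0// -powRrM; congr (_ `^ _).
by field.
Qed.

End powR.

(** * Minimization of the leading part at fixed [n] *)

Section minimization.
Context {R : realType}.
Variables (c a b : R).
Hypotheses (a0 : 0 < a) (b0 : 0 < b).

(** [c], [a] and [b] stand for [sigma2 / n], [VS / n] and [bS ^+ 2]. *)
Let g m : R := c - m `^ (- (1 / 2)) * a + m `^ (- 2) * b.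
(** The zero of [4 * b * t ^+ 3 - a], the derivative in [t]. *)
Let t0 : R := (a / (4 * b)) `^ (1 / 3).

Let m0 : R := (4 * b / a) `^ (2 / 3).

Let t0_gt0 : 0 < t0.
Proof. by rewrite powR_gt0// divr_gt0// mulr_gt0. Qed.

Let t0X3 : a = 4 * b * t0 ^+ 3.
Proof.
rewrite (powR_rootn_exprn 2) ?divr_ge0 ?mulr_ge0 ?(ltW a0) ?(ltW b0)//.
by field; rewrite gt_eqF.
Qed.

Let m0_t0 : m0 `^ (- (1 / 2)) = t0.
Proof.
rewrite /m0 /t0 -powRrM -(invf_div (4 * b)).
have h : 0 < 4 * b / a by rewrite divr_gt0// mulr_gt0.
by rewrite -(powR_inv1 (ltW h)) -powRrM; congr (_ `^ _); field.
Qed.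

(** Since [a = 4 * b * t0 ^+ 3], the difference is [b] times [t ^ 4 - 4 * t0 ^ 3 * t + 3 * t0 ^ 4],
    which has the double root [t0]. *)
Lemma sub_leading_min (m : R) : 0 < m -> g m - g m0 =
  b * (m `^ (- (1 / 2)) - t0) ^+ 2 *
    (m `^ (- (1 / 2)) ^+ 2 + 2 * m `^ (- (1 / 2)) * t0 + 3 * t0 ^+ 2).
Proof.
move=> m1; have m00 : 0 < m0 by rewrite powR_gt0// divr_gt0// mulr_gt0.
rewrite /g (powRN2E m1) (powRN2E m00) m0_t0 [in LHS]t0X3.
by ring.
Qed.

Lemma leading_min_value : g m0 = c - 3 * b * t0 ^+ 4.
Proof.
have m00 : 0 < m0 by rewrite powR_gt0// divr_gt0// mulr_gt0.
rewrite /g (powRN2E m00) m0_t0 [in LHS]t0X3; ring.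
Qed.

(** The quadratic cofactor is positive, so a minimizer has [t = t0], and [t] determines [m]. *)
Lemma leading_minP (m : R) : minimizes_on_pos g m <-> m = m0.
Proof.
have m00 : 0 < m0 by rewrite powR_gt0// divr_gt0// mulr_gt0.
have pos m' : 0 < m' ->
    0 < m' `^ (- (1 / 2)) ^+ 2 + 2 * m' `^ (- (1 / 2)) * t0 + 3 * t0 ^+ 2.
  move=> m'0; have t := powR_gt0 (- (1 / 2)) m'0.
  by rewrite !addr_gt0 ?mulr_gt0 ?exprn_gt0.
split=> [[m1 mmin]|->]; last first.
  split=> // m' m'0; rewrite -subr_ge0 sub_leading_min// mulr_ge0 ?(ltW (pos _ _))//.
  by rewrite mulr_ge0 ?sqr_ge0// ltW.
have := mmin _ m00; rewrite -subr_le0 sub_leading_min// pmulr_lle0 ?pos//.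
rewrite pmulr_rle0// => h.
have : (m `^ (- (1 / 2)) - t0) ^+ 2 == 0 by rewrite eq_le h sqr_ge0.
rewrite sqrf_eq0 subr_eq0 -m0_t0 => /eqP.
by rewrite !powRN => /invr_inj; apply: powR_injective; rewrite ?nnegrE ?ltW//.
Qed.

End minimization.

(** * Little-o along paths and for sums *)

Section little_o.
Context {R : realType}.

(** The joint limit imposes no relation between [m] and [n], so any path [m = mo n] going to
    infinity is admissible. *)
Lemma little_o_diagonal {r v : R * nat -> R} {mo : nat -> R} :
  mo @ \oo --> pinfty_nbhs R ->
  little_o (filter_prod (pinfty_nbhs R) \oo) r v ->
  little_o \oo (fun n => r (mo n, n)) (fun n => v (mo n, n)).
Proof.
move=> moy rv; apply: (cvg_comp (fun n => (mo n, n)) _ _ rv).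
move=> S [[A B] /= [mA nB] AB].
have hA : \forall n \near \oo, A (mo n) by exact: moy.
have hB : \forall n \near \oo, B n by [].
by near=> n; apply: AB; split => /=; near: n.
Unshelve. all: by end_near. Qed.

(** Dividing by [v] instead of [v1] and [v2] costs only the constant factors [k1] and [k2]. *)
Lemma little_oD {I : Type} {G : set_system I} {FG : Filter G} {u1 u2 v1 v2 v : I -> R}
    {k1 k2 : R} :
  little_o G u1 v1 -> little_o G u2 v2 ->
  (\forall i \near G, v1 i != 0 /\ v2 i != 0 /\ v1 i = k1 * v i /\ v2 i = k2 * v i) ->
  little_o G (fun i => u1 i + u2 i) v.
Proof.
move=> h1 h2 hv.
have h : `|k1| * `|u1 i / v1 i| + `|k2| * `|u2 i / v2 i| @[i --> G] --> (0 : R).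
  have c1 : `|k1| * `|u1 i / v1 i| @[i --> G] --> `|k1| * 0 by exact: cvgMl_tmp h1.
  have c2 : `|k2| * `|u2 i / v2 i| @[i --> G] --> `|k2| * 0 by exact: cvgMl_tmp h2.
  by have := cvgD c1 c2; rewrite !mulr0 addr0; exact.
apply: (squeeze_cvgr _ (cvg_cst 0) h).
near=> i.
have [v1i [v2i [e1 e2]]] : v1 i != 0 /\ v2 i != 0 /\ v1 i = k1 * v i /\ v2 i = k2 * v i.
  by near: i.
rewrite normr_ge0 /= -!normrM (le_trans _ (ler_normD _ _))//.
rewrite e1 in v1i *; rewrite e2 in v2i *.
move: v1i v2i; rewrite !mulf_eq0 !negb_or => /andP[k10 v0] /andP[k20 _].
rewrite le_eqVlt; apply/orP; left; apply/eqP; congr `|_|.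
by field; rewrite v0 k10 k20.
Unshelve. all: by end_near. Qed.

End little_o.

(** * Error terms of the expansion of the MSE *)

Section leading_part.
Context {R : realType}.
Variables (F f f' : R -> R) (x : R).
Hypotheses (x0 : 0 < x) (F01 : forall y, 0 <= F y <= 1).
Hypotheses (Ff : forall y : R, 0 < y -> is_derive y 1 F (f y))
  (ff' : is_derive x 1 f (f' x)).

Let B m := szasz_mean F x m.
Let A m := szasz_min_mean F x m.

(** Division by [m ^ -2] turns this into the square of the limit [szasz_bias_cvg]. *)
Lemma sqr_bias_little_o :
  little_o (filter_prod (pinfty_nbhs R) \oo)
    (fun p : R * nat => (B p.1 - F x) ^+ 2 - p.1 `^ (- 2) * bS f' x ^+ 2)
    (fun p => p.1 `^ (- 2)).
Proof.
have h0 : `|(m * (B m - F x)) ^+ 2 - bS f' x ^+ 2| @[m --> pinfty_nbhs R] --> (0 : R).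
  apply/norm_cvg0P; rewrite -(subrr (bS f' x ^+ 2)); apply: cvgB; last exact: cvg_cst.
  have h := szasz_bias_cvg F f x (f' x) x0 F01 Ff ff'.
  rewrite /bS (mulrC x) expr2 (_ : (fun m => _) =
    (fun m => m * (B m - F x)) * (fun m => m * (B m - F x))); first exact: (cvgM h h).
  by apply/funext => m; rewrite expr2.
rewrite /little_o.
apply: (cvg_trans _ (cvg_comp _ _ cvg_fst h0)).
apply: near_eq_cvg; exists ([set m | 0 < m], setT) => /=.
  split; last exact: filterT.
  by apply: nbhs_pinfty_gt; exact: num_real.
- move=> [m n] /= [m0 _]; congr `|_|.
  rewrite (powR_invn 2 (ltW m0)).
  by field; rewrite gt_eqF.
exact: (@filter_filter _ _ eventually_filter).
Qed.

(** The factor [1 / n] cancels, and the bracket is [O(1 / m)], hence negligible before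
    [m ^ (-1/2)]. *)
Lemma variance_little_o :
  little_o (filter_prod (pinfty_nbhs R) \oo)
    (fun p : R * nat => p.2%:R^-1 *
      (A p.1 - B p.1 ^+ 2 - sigma2 F x + p.1 `^ (- (1 / 2)) * VS f x))
    (fun p => p.1 `^ (- (1 / 2)) * p.2%:R^-1).
Proof.
have [K K0 hK] := szasz_mean_bound F f x (f' x) x0 F01 Ff ff'.
have [L L0 hL] := szasz_min_mean_bound F f x (f' x) x0 F01 Ff ff'.
(* [B ^+ 2 - F x ^+ 2] factors as [(B - F x) * (B - F x + 2 * F x)], of factors at most [K / m] and
   [K + 2] in absolute value. *)
set C := L + K * (K + 2).
have C0 : 0 <= C by rewrite addr_ge0// mulr_ge0// addr_ge0.
apply/cvgrPdist_le => e e0.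
(* The second condition amounts to [C / Num.sqrt m <= e]. *)
exists ([set m | 1 <= m /\ (C / e) ^+ 2 <= m], [set n | (0 < n)%N]) => /=.
  split; last by exists 1%N.
  near=> m; split; near: m; apply: nbhs_pinfty_ge; exact: num_real.
move=> [m n] /= [[m1 mC] n0].
have m0 : 0 < m by rewrite (lt_le_trans ltr01).
have s0 : 0 < Num.sqrt m by rewrite sqrtr_gt0.
have mE : m = Num.sqrt m ^+ 2 by rewrite sqr_sqrtr// ltW.
have nn : n%:R != 0 :> R by rewrite pnatr_eq0 -lt0n.
rewrite (powRN_halfE m0) sub0r normrN normr_id.
have VE : VS f x = f x * Num.sqrt (x / pi).
  by rewrite /VS powR_half// divr_ge0 ?pi_ge0// ltW.
have hm := hK _ m1; have hm2 := hL _ m1; rewrite -/(B m) -/(A m) -VE in hm hm2.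
have Fx : `|F x| <= 1 by have /andP[h1 h2] := F01 x; rewrite ger0_norm.
have Km : K / m <= K by rewrite ler_pdivrMr// ler_peMr.
have hD : `|A m - B m ^+ 2 - sigma2 F x + (Num.sqrt m)^-1 * VS f x| <= C / m.
  rewrite (_ : _ + _ = (A m - F x + (Num.sqrt m)^-1 * VS f x)
    - (B m - F x) * ((B m - F x) + 2 * F x)); last by rewrite /sigma2; ring.
  rewrite (le_trans (ler_normB _ _))// [leRHS]mulrDl lerD//.
  rewrite normrM [leRHS]mulrAC ler_pM// (le_trans (ler_normD _ _))// lerD//.
    exact: le_trans Km.
  by rewrite normrM ger0_norm// -[leRHS]mulr1 ler_wpM2l.
rewrite (_ : _ / _ =
    (A m - B m ^+ 2 - sigma2 F x + (Num.sqrt m)^-1 * VS f x) * Num.sqrt m); last by field; rewrite nn gt_eqF.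
rewrite normrM (gtr0_norm s0) (le_trans (ler_wpM2r (ltW s0) hD))//.
rewrite {1}mE [leLHS](_ : _ = C / Num.sqrt m); last by field; rewrite gt_eqF.
rewrite ler_pdivrMr// mulrC -ler_pdivrMr//.
have Ce : 0 <= C / e by rewrite divr_ge0// ltW.
by rewrite -(ger0_norm Ce) -sqrtr_sqr ler_wsqrtr.
Unshelve. all: by end_near. Qed.

End leading_part.

(** * Sign of the density, growth of [m_opt], and the optimal MSE *)

Lemma cdf_fun_ge0_le1 {d} {T : measurableType d} {R : realType}
    {P : probability T R} {X : {RV P >-> R}} {F : R -> R} :
  (forall y, cdf X y = (F y)%:E) -> forall y, 0 <= F y <= 1.
Proof. by move=> XF y; rewrite -!lee_fin -XF cdf_ge0 cdf_le1. Qed.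

(** If [l < 0], the linear approximation with error slope [- l / 2] would make [F] decrease just to
    the right of [x]. *)
Lemma is_derive_nondecreasing_ge0 {R : realType} {F : R -> R} {x l : R} :
  {homo F : y z / y <= z} -> is_derive x 1 F l -> 0 <= l.
Proof.
move=> Fnd Fl; rewrite leNgt; apply/negP => l0.
have e0 : 0 < - l / 2 by rewrite divr_gt0// oppr_gt0.
have /nbhs_ballP[d /= d0 hd] := is_derive_linear_approx Fl _ e0.
have := hd (x + d / 2); rewrite /ball /= opprD addNKr normrN gtr0_norm ?divr_gt0//.
have d2 : 0 < d / 2 by rewrite divr_gt0.
rewrite ltr_pdivrMr// mulr_natr mulr2n ltrDl d0 => /(_ isT).
have -> : x + d / 2 - x = d / 2 by rewrite addrAC subrr add0r.
rewrite (gtr0_norm d2) ler_norml => /andP[_].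
have : F x <= F (x + d / 2) by rewrite Fnd// lerDl ltW.
have : l * (d / 2) < 0 by rewrite pmulr_llt0.
nra.
Qed.

Lemma m_opt_cvg_pinfty {R : realType} (f f' : R -> R) (x : R) :
  0 < 4 * bS f' x ^+ 2 / VS f x -> m_opt f f' x @ \oo --> pinfty_nbhs R.
Proof.
(* As the inverse of [3 / 2], the exponent shows the threshold for [n]: it is [z ^ (3/2)]. *)
rewrite /m_opt (_ : 2 / 3 = (3 / 2)^-1); last by field.
set q := _ / VS f x => q0.
have k0 : 0 < q `^ (3 / 2)^-1 by rewrite powR_gt0.
apply/cvgryPge => y; near=> n; rewrite -ler_pdivrMr//.
set z := `|y / q `^ (3 / 2)^-1|.
have zn : z `^ (3 / 2) <= n%:R by near: n; exact: nbhs_infty_ger.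
rewrite (le_trans (ler_norm _))// -/z.
have z0 : 0 <= z by exact: normr_ge0.
have zE : z = (z `^ (3 / 2)) `^ (3 / 2)^-1.
  by rewrite -powRrM divff ?powRr1// gt_eqF// divr_gt0.
by rewrite zE ge0_ler_powR ?nnegrE ?powR_ge0 ?ler0n// invr_ge0 divr_ge0.
Unshelve. all: by end_near. Qed.

Theorem corollary2 (R : realType) (d : measure_display) (T : measurableType d)
    (P : probability T R) (X : nat -> {RV P >-> R}) (F f f' : R -> R)
    (X_indep : mutually_independent X)
    (X_ge0 : forall i w, 0 <= X i w)
    (X_cdf : forall i y, cdf (X i) y = (F y)%:E)
    (F0 : F 0 = 0)
    (F_cont : continuous F)
    (F_deriv : derivative_on_nneg F f)
    (f_deriv : derivative_on_nneg f f')
    (f_cont : {within `[0, +oo[, continuous f})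
    (f'_cont : {within `[0, +oo[, continuous f'})
    (f_bounded : [bounded f y | y in `[0, +oo[])
    (f'_bounded : [bounded f' y | y in `[0, +oo[])
    (x : R) (x_gt0 : 0 < x) (fx_neq0 : f x <> 0) (f'x_neq0 : f' x <> 0) :
  (forall mo : nat -> R,
     asymptotically_optimal (fun m n => szasz_mse X F m n x)
                            (mse_leading_part F f f' x) mo
     <-> forall n, (0 < n)%N -> mo n = m_opt f f' x n) /\
  little_o \oo
    (fun n => szasz_mse X F (m_opt f f' x n) n x
              - (n%:R^-1 * sigma2 F x
                 - 3 / 4 * n%:R `^ (- (4 / 3))
                   * (VS f x ^+ 4 / (4 * bS f' x ^+ 2)) `^ (1 / 3)))
    (fun n => n%:R `^ (- (4 / 3))).
Proof.
have F01 := cdf_fun_ge0_le1 (X_cdf 0%N).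
have Ff := F_deriv.1.
have ff' := f_deriv.1 _ x_gt0.
have Fnd : {homo F : y z / y <= z}.
  by move=> y z yz; rewrite -lee_fin -!(X_cdf 0%N); exact: cdf_nondecreasing.
have fx0 : 0 < f x.
  rewrite lt_neqAle (is_derive_nondecreasing_ge0 Fnd (Ff _ x_gt0)) andbT.
  by rewrite eq_sym; exact/eqP.
have V0 : 0 < VS f x by rewrite mulr_gt0// powR_gt0// divr_gt0// pi_gt0.
have b0 : 0 < bS f' x ^+ 2.
  by rewrite exprn_even_gt0//= !mulf_neq0// ?(gt_eqF x_gt0)//; exact/eqP.
have leading : has_leading_part (fun m n => szasz_mse X F m n x)
    (mse_leading_part F f f' x).
  (* The two remainders are fixed by the lemmas on the squared bias and on the variance. *)
  do 2 eexists; split.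
  - exact: (sqr_bias_little_o F f f' x x_gt0 F01 Ff ff').
  - exact: (variance_little_o F f f' x x_gt0 F01 Ff ff').
  - move=> m n m0 n0 /=.
    by rewrite (szasz_mseE P X F X_indep X_cdf m x m0 x_gt0 n n0) /mse_leading_part; ring.
have a0 n : (0 < n)%N -> 0 < n%:R^-1 * VS f x.
  by move=> ?; rewrite mulr_gt0// invr_gt0 ltr0n.
have q0 : 0 < 4 * bS f' x ^+ 2 / VS f x by rewrite divr_gt0// mulr_gt0.
(* This is the minimizer of the previous section for [a = VS / n]. *)
have moE n : (0 < n)%N ->
    m_opt f f' x n = (4 * bS f' x ^+ 2 / (n%:R^-1 * VS f x)) `^ (2 / 3).
  move=> n0; rewrite /m_opt -powRM ?ler0n ?(ltW q0)//.
  by congr (_ `^ _); field; rewrite (gt_eqF V0) pnatr_eq0 -lt0n n0.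
have LE n : mse_leading_part F f f' x ^~ n = fun m =>
    n%:R^-1 * sigma2 F x - m `^ (- (1 / 2)) * (n%:R^-1 * VS f x)
    + m `^ (- 2) * bS f' x ^+ 2.
  by apply/funext => m; rewrite /mse_leading_part; ring.
split.
  move=> mo; split=> [[_ h] n n0|h].
    by rewrite moE//; apply/(leading_minP (n%:R^-1 * sigma2 F x) _ _ (a0 _ n0) b0);
      rewrite -LE; exact: h.
  split=> // n n0; rewrite LE.
  by apply/(leading_minP (n%:R^-1 * sigma2 F x) _ _ (a0 _ n0) b0); rewrite -moE// h.
have [r1 [r2 [h1 h2 hE]]] := leading.
have moy := m_opt_cvg_pinfty f f' x q0.
have mo0 n : (0 < n)%N -> 0 < m_opt f f' x n.
  by move=> n0; rewrite mulr_gt0// powR_gt0// ltr0n.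
have mo1 := little_o_diagonal moy h1.
have mo2 := little_o_diagonal moy h2.
set q := 4 * bS f' x ^+ 2 / VS f x in q0.
(* In terms of [nu], the cube root of [n], all powers of [n] have integer exponents. *)
pose nu n : R := n%:R `^ (1 / 3).
have nu0 n : (0 < n)%N -> 0 < nu n by move=> n0; rewrite powR_gt0// ltr0n.
have nuX3 n : nu n ^+ 3 = n%:R by apply: (powR_rootn_exprn 2); exact: ler0n.
have NE n : n%:R `^ (- (4 / 3)) = (nu n)^-1 ^+ 4.
  by rewrite powRN (powR_div_exprn 4 _ 3) ?ler0n// exprVn.
have val n : (0 < n)%N -> mse_leading_part F f f' x (m_opt f f' x n) n =
    n%:R^-1 * sigma2 F x
    - 3 / 4 * n%:R `^ (- (4 / 3)) * (VS f x ^+ 4 / (4 * bS f' x ^+ 2)) `^ (1 / 3).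
  move=> n0; have := LE n => /(congr1 (fun g => g (m_opt f f' x n))) /= ->.
  rewrite moE// (leading_min_value _ _ _ (a0 _ n0) b0) NE; congr (_ - _).
  have c0 : 0 < 4 * bS f' x ^+ 2 by rewrite mulr_gt0.
  have h0 := ltW (divr_gt0 V0 c0).
  have -> : (n%:R^-1 * VS f x / (4 * bS f' x ^+ 2)) `^ (1 / 3) =
      (nu n)^-1 * (VS f x / (4 * bS f' x ^+ 2)) `^ (1 / 3).
    rewrite -mulrA [in LHS]powRM ?invr_ge0 ?ler0n//; congr (_ * _).
    by rewrite -(powR_inv1 (ler0n R n)) powRAC powR_inv1 ?powR_ge0.
  have -> : (VS f x ^+ 4 / (4 * bS f' x ^+ 2)) `^ (1 / 3) =
      (VS f x / (4 * bS f' x ^+ 2)) `^ (1 / 3) ^+ 4 * (4 * bS f' x ^+ 2).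
    (* The cube makes the cube root of the second factor explicit. *)
    rewrite (_ : VS f x ^+ 4 / _ =
      (VS f x / (4 * bS f' x ^+ 2)) ^+ 4 * (4 * bS f' x ^+ 2) ^+ 3); last first.
      by field; rewrite -sqrf_eq0 gt_eqF.
    rewrite powRM ?exprn_ge0 ?(ltW c0)// (powR_exprn_rootn 2) ?(ltW c0)//.
    by rewrite -[_ ^+ 4]powR_mulrn// powRAC powR_mulrn ?powR_ge0.
  by field; rewrite (gt_eqF (nu0 _ n0)).
have moN n : (0 < n)%N -> m_opt f f' x n `^ (- (1 / 2)) =
    (nu n)^-1 * q `^ (- (1 / 3)).
  move=> n0; rewrite /m_opt powRM ?powR_ge0// -!powRrM -powRN.
  by congr (_ `^ _ * _ `^ _); field.
pose k := q `^ (- (1 / 3)).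
have k0 : 0 < k by rewrite powR_gt0.
have near_pos : \forall n \near \oo, (0 < n)%N by exists 1%N.
have main : little_o \oo
    (fun n => r1 (m_opt f f' x n, n) + r2 (m_opt f f' x n, n))
    (fun n => n%:R `^ (- (4 / 3))).
  (* At [m_opt], [m ^ -2] is [k ^+ 4 * n ^ (-4/3)] and [m ^ (-1/2) / n] is [k * n ^ (-4/3)]: both
     remainders have the same order. *)
  apply: (little_oD (k1 := k ^+ 4) (k2 := k) mo1 mo2); near=> n => /=.
  have n0 : (0 < n)%N by near: n.
  rewrite (powRN2E (mo0 _ n0)) moN// -/k NE -(nuX3 n).
  have nn := nu0 _ n0.
  have nk : 0 < (nu n)^-1 * k by rewrite mulr_gt0// invr_gt0.
  split; first by rewrite gt_eqF// exprn_gt0.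
  split; first by rewrite gt_eqF// divr_gt0// exprn_gt0.
  split; first by rewrite exprMn mulrC.
  by field; rewrite gt_eqF.
apply: (cvg_trans _ main); apply: near_eq_cvg; near=> n.
have n0 : (0 < n)%N by near: n.
by rewrite hE ?mo0// val//; congr (`|_ / _|); ring.
Unshelve. all: by end_near. Qed.
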